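(* Let $A$ denote a $V$-elliptic Lax--Milgram operator, defined from a triple $(H,V,a)$, such that $A$ is hyponormal or such that $A^2$ is accretive, and let $u(t)=e^{-tA}u_0$, $t\geq 0$, be the solution of $\partial_tu+\mathcal{A}u=0$, $u(0)=u_0$, where $u_0\in H$ with $|u_0|=1$. Then $h(t)=|u(t)|$ is strictly decreasing and strictly convex for $t\ge0$ and differentiable from the right at $t=0$ (where the value $h'(0)=-\infty$ is allowed if $u_0\in H\setminus D(A)$) with $$h'(0)=-\operatorname{Re}(Au_0\,|\,u_0)\qquad\text{for }u_0\in D(A),$$ and generally $$h'(0)\le-m(A).$$
   Context: $V$ and $H$ are separable complex Hilbert spaces, $V\subseteq H$ algebraically, topologically and densely, and $V^*$ is the antidual of $V$ (conjugate-linear functionals), so $V\subseteq H\equiv H^*\subseteq V^*$; $\|\cdot\|$ and $|\cdot|$ are the norms on $V$ and $H$, $(\cdot|\cdot)$ the inner product of $H$, and $\langle\cdot,\cdot\rangle$ the sesquilinear duality on $V^*\times V$ extending $(\cdot|\cdot)$ on $H\times V$. The sesquilinear form $a$ on $V$ is bounded and $V$-elliptic: there are $C_3,C_4>0$ with $|a(u,v)|\le C_3\|u\|\|v\|$ and $\operatorname{Re}a(v,v)\ge C_4\|v\|^2$ for all $u,v\in V$. $\mathcal{A}\colon V\to V^*$ is given by $\langle\mathcal{A}u,v\rangle=a(u,v)$, and the Lax--Milgram operator $A$ in $H$ is $Au=\mathcal{A}u$ with $D(A)=\{u\in V\mid\mathcal{A}u\in H\}$. $-A$ generates an analytic semigroup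 $e^{-tA}$ on $H$. $A$ is hyponormal if $D(A)\subset D(A^* )$ and $|A^*u|\le|Au|$ for all $u\in D(A)$. For an operator $S$ in $H$, the lower bound is $m(S)=\inf\{\operatorname{Re}(Su|u)\mid u\in D(S),\ |u|=1\}$; $S$ is accretive if $m(S)\ge0$. $h'(0)$ denotes the right derivative $\lim_{t\to0^+}(h(t)-h(0))/t$. *)

(* Defs.v *)
From HB Require Import structures.
From mathcomp Require Import all_boot all_order all_algebra.
From mathcomp Require Import sesquilinear complex.
From mathcomp Require Import all_classical all_reals.
From mathcomp Require Import topology normedtype ereal.

Set Implicit Arguments.
Unset Strict Implicit.
Unset Printing Implicit Defensive.

Import Order.TTheory GRing.Theory Num.Theory Num.Def.
Import numFieldNormedType.Exports.

Local Open Scope classical_set_scope.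
Local Open Scope complex_scope.
Local Open Scope ring_scope.

(* The inner product is linear in its first argument and conjugate-linear in
   the second one. *)
HB.mixin Record isHilbert (R : realType) H of CompleteNormedModule R[i] H := {
  inner : {dot H for (@conjC R[i])} ;
  inner_normE : forall x : H, inner x x = `|x| ^+ 2
}.

#[short(type="hilbertType")]
HB.structure Definition Hilbert (R : realType) :=
  { H of isHilbert R H & CompleteNormedModule R[i] H }.

Definition separable (T : topologicalType) : Prop :=
  exists2 D : set T, countable D & dense D.

(* Norms over R[i] take (real) values in R[i]; rnorm is R-valued. *)
Definition rnorm (R : realType) (H : normedModType R[i]) (x : H) : R :=
  complex.Re `|x|.

Section Operators.
Context {R : realType} {H : hilbertType R}.

(* An unbounded operator; the values of op outside dom are irrelevant. *)
Record operator := Operator { dom : set H ; op :> H -> H }.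

Definition opp_operator (S : operator) : operator :=
  Operator (dom S) (fun x => - S x).

Definition square (S : operator) : operator :=
  Operator [set x | dom S x /\ dom S (S x)] (fun x => S (S x)).

Definition adjoint_at (S : operator) (y z : H) : Prop :=
  forall x, dom S x -> inner (S x) y = inner x z.

(* The value z is unique when dom S is dense. *)
Definition adjoint (S : operator) : operator :=
  Operator [set y | exists z, adjoint_at S y z]
           (fun y => xget 0 [set z | adjoint_at S y z]).

Definition hyponormal (S : operator) : Prop :=
  dom S `<=` dom (adjoint S) /\
  forall x, dom S x -> rnorm (adjoint S x) <= rnorm (S x).

Definition lower_bound (S : operator) : \bar R :=
  ereal_inf [set (complex.Re (inner (S x) x))%:E
            | x in [set x | dom S x /\ rnorm x = 1]].

Definition accretive (S : operator) : Prop := (0%:E <= lower_bound S)%E.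

(* T t is only constrained for 0 <= t. *)
Record C0_semigroup (T : R -> H -> H) : Prop := {
  C0_linear : forall t, 0 <= t -> linear (T t) ;
  C0_continuous : forall t, 0 <= t -> continuous (T t) ;
  C0_0 : forall x, T 0 x = x ;
  C0_add : forall s t x, 0 <= s -> 0 <= t -> T (s + t) x = T s (T t x) ;
  C0_strong : forall x, T t x @[t --> 0^'+] --> x
}.

(* Equality of graphs: in particular dom G is exactly the set of those x for
   which the limit exists. *)
Definition is_generator (G : operator) (T : R -> H -> H) : Prop :=
  forall x y : H,
    ((t^-1)%:C *: (T t x - x) @[t --> 0^'+] --> y) <-> (dom G x /\ G x = y).

End Operators.
Arguments operator {R} H.

Section Triple.
Context {R : realType} {V H : hilbertType R}.

(* j plays the role of the inclusion of V into H. *)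
Record dense_embedding (j : {linear V -> H}) : Prop := {
  embedding_inj : injective j ;
  embedding_continuous : continuous j ;
  embedding_dense : dense (range j)
}.

(* The element of the antidual of V given by f in H. *)
Definition to_antidual (j : V -> H) (f : H) : V -> R[i] :=
  fun v => inner f (j v).

Definition sesquilinear_form :=
  {bilinear V -> V -> R[i] | *%R & (@conjC R[i] \; *%R)}.

Definition bounded_form (a : sesquilinear_form) : Prop :=
  exists2 C : R, 0 < C &
    forall u v, complex.Re `|a u v| <= C * rnorm u * rnorm v.

Definition elliptic_form (a : sesquilinear_form) : Prop :=
  exists2 C : R, 0 < C & forall v, C * rnorm v ^+ 2 <= complex.Re (a v v).

(* u |-> a(u, .), with values in the antidual of V. *)
Definition form_operator (a : sesquilinear_form) (u : V) : V -> R[i] :=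
  fun v => a u v.

Definition lax_milgram_at (j : V -> H) (a : sesquilinear_form) (x f : H) :=
  exists2 u : V, j u = x & form_operator a u =1 to_antidual j f.

Definition lax_milgram (j : V -> H) (a : sesquilinear_form) : operator H :=
  Operator [set x | exists f, lax_milgram_at j a x f]
           (fun x => xget 0 [set f | lax_milgram_at j a x f]).

End Triple.
Arguments sesquilinear_form {R} V.

Section RealFunctions.
Context {R : realType}.

Definition strictly_decreasing_on (D : set R) (h : R -> R) : Prop :=
  forall s t, D s -> D t -> s < t -> h t < h s.

Definition strictly_convex_on (D : set R) (h : R -> R) : Prop :=
  forall s t l : R, D s -> D t -> s != t -> 0 < l -> l < 1 ->
    h (l * s + (1 - l) * t) < l * h s + (1 - l) * h t.

Definition right_derivative (h : R -> R) (x : R) (l : \bar R) : Prop :=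
  ((h (x + t) - h x) / t)%:E @[t --> 0^'+] --> l.

End RealFunctions.

(* Main.v *)
(* Let u be the orbit of u0 and h its norm. For t > 0,
     h' = - Re(Au|u) / |u|  and
     |u|^3 h'' = (|Au|^2 + Re(A^2 u|u)) |u|^2 - (Re(Au|u))^2,
   and the last expression is positive as soon as u <> 0: if A^2 is accretive by
   the equality case of Cauchy-Schwarz, and if A is hyponormal because
   2 Re(Au|u) = Re((A + A^* )u|u). So h' is increasing on ]0, +oo[ and the mean
   value theorem gives everything, provided that u(t) lies in D(A^2) and does not
   vanish for t > 0.

   Smoothing: ellipticity and boundedness of the form make
   t^2 |Au(t)|^2 + K^2 |u(t)|^2 nonincreasing, so |A e^(-tA)| <= K / t.
   Nonvanishing: hence |A^n e^(-tA)| <= (n K / t)^n, and if u vanishes at tau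
   then the Taylor expansion at tau shows that u vanishes already at q tau, for
   some q < 1 depending only on K; iterating, u0 = 0. *)

Require Import Defs.
From mathcomp Require Import all_boot all_order all_algebra.
From mathcomp Require Import sesquilinear complex.
From mathcomp Require Import all_classical all_reals.
From mathcomp Require Import topology normedtype ereal.
From mathcomp Require Import sequences derive realfun exp.
From mathcomp Require Import ring lra.

Set Implicit Arguments.
Unset Strict Implicit.
Unset Printing Implicit Defensive.

Import Order.TTheory GRing.Theory Num.Theory.
Import numFieldNormedType.Exports.

Local Open Scope classical_set_scope.
Local Open Scope ring_scope.

(** * The underlying real inner product space *)
Section RealInner.
Context {R : realType} {H : hilbertType R}.
Implicit Types (x y z : H) (r s : R).
Local Open Scope complex_scope.

Definition rip x y : R := complex.Re (inner x y).
Definition rscale r x : H := r%:C *: x.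

Lemma ReD (z w : R[i]) : complex.Re (z + w) = complex.Re z + complex.Re w.
Proof. by case: z => a b; case: w. Qed.

Lemma ReN (z : R[i]) : complex.Re (- z) = - complex.Re z.
Proof. by case: z. Qed.

Lemma ReZ r (z : R[i]) : complex.Re (r%:C * z) = r * complex.Re z.
Proof. by case: z => a b /=; rewrite mul0r subr0. Qed.

Lemma conjC_real r : ((r%:C)^* )%R = r%:C.
Proof. by apply/eqP; rewrite eq_complex /= oppr0 !eqxx. Qed.

Lemma Re_conj (z : R[i]) : complex.Re (z^* )%R = complex.Re z.
Proof. by case: z. Qed.

Lemma ripC x y : rip x y = rip y x.
Proof. by rewrite /rip hermC expr0 mul1r Re_conj. Qed.

Lemma ripDl x y z : rip (x + y) z = rip x z + rip y z.
Proof. by rewrite /rip linearDl ReD. Qed.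

Lemma ripNl x z : rip (- x) z = - rip x z.
Proof. by rewrite /rip linearNl ReN. Qed.

Lemma ripBl x y z : rip (x - y) z = rip x z - rip y z.
Proof. by rewrite ripDl ripNl. Qed.

Lemma ripZl r x z : rip (rscale r x) z = r * rip x z.
Proof. by rewrite /rip linearZl_LR /= ReZ. Qed.

Lemma ripDr x y z : rip z (x + y) = rip z x + rip z y.
Proof. by rewrite !(ripC z) ripDl. Qed.
Lemma ripNr x z : rip z (- x) = - rip z x.
Proof. by rewrite !(ripC z) ripNl. Qed.
Lemma ripBr x y z : rip z (x - y) = rip z x - rip z y.
Proof. by rewrite ripDr ripNr. Qed.
Lemma ripZr r x z : rip z (rscale r x) = r * rip z x.
Proof. by rewrite !(ripC z) ripZl. Qed.
Lemma rip0l z : rip 0 z = 0.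
Proof. by rewrite /rip linear0l. Qed.
Lemma rip0r z : rip z 0 = 0.
Proof. by rewrite ripC rip0l. Qed.

Definition ripE := (ripDl, ripDr, ripNl, ripNr, ripZl, ripZr, rip0l, rip0r).

Lemma norm_rnormE x : `|x| = (rnorm x)%:C.
Proof.
have := normr_ge0 x; rewrite /rnorm; case: `|x| => a b.
by rewrite lecE /= => /andP[/eqP -> _].
Qed.

Lemma rnorm_ge0 x : 0 <= rnorm x.
Proof. by have := normr_ge0 x; rewrite norm_rnormE lecE /= => /andP[]. Qed.

Lemma rip_sqr x : rip x x = rnorm x ^+ 2.
Proof. by rewrite /rip inner_normE norm_rnormE -rmorphXn. Qed.

Lemma rnormD x y : rnorm (x + y) <= rnorm x + rnorm y.
Proof. by have := ler_normD x y; rewrite !norm_rnormE -rmorphD lecR. Qed.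
Lemma rnormN x : rnorm (- x) = rnorm x.
Proof. by rewrite /rnorm normrN. Qed.
Lemma rnormB x y : rnorm (x - y) <= rnorm x + rnorm y.
Proof. by rewrite -(rnormN y) rnormD. Qed.
Lemma rnormBC x y : rnorm (x - y) = rnorm (y - x).
Proof. by rewrite -rnormN opprB. Qed.
Lemma rnorm0 : rnorm (0 : H) = 0.
Proof. by rewrite /rnorm normr0. Qed.
Lemma rnormZ r x : rnorm (rscale r x) = `|r| * rnorm x.
Proof.
apply/eqP; rewrite -(@eqrXn2 _ 2)// ?mulr_ge0 ?rnorm_ge0//.
by rewrite exprMn real_normK ?num_real// -!rip_sqr ripZl ripZr mulrA expr2.
Qed.
Lemma rnorm_eq0 x : (rnorm x == 0) = (x == 0).
Proof. by rewrite -(normr_eq0 x) norm_rnormE eq_complex /= eqxx andbT. Qed.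
Lemma rnorm_gt0 x : (0 < rnorm x) = (x != 0).
Proof. by rewrite lt_def rnorm_ge0 andbT rnorm_eq0. Qed.
Lemma rnorm_distD z x y : rnorm (x - y) <= rnorm (x - z) + rnorm (z - y).
Proof. by apply: le_trans (rnormD _ _); rewrite addrA subrK. Qed.

Lemma rscaleDr r x y : rscale r (x + y) = rscale r x + rscale r y.
Proof. exact: scalerDr. Qed.
Lemma rscaleNr r x : rscale r (- x) = - rscale r x.
Proof. exact: scalerN. Qed.
Lemma rscaleBr r x y : rscale r (x - y) = rscale r x - rscale r y.
Proof. exact: scalerBr. Qed.
Lemma rscaleNl r x : rscale (- r) x = - rscale r x.
Proof. by rewrite /rscale rmorphN scaleNr. Qed.
Lemma rscaleA r s x : rscale r (rscale s x) = rscale (r * s) x.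
Proof. by rewrite /rscale scalerA rmorphM. Qed.
Lemma rscale1 x : rscale 1 x = x.
Proof. exact: scale1r. Qed.
Lemma cauchy_schwarz_sqr x y : rip x y ^+ 2 <= rip x x * rip y y.
Proof.
have [->|y0] := eqVneq y 0; first by rewrite !ripE mulr0 expr0n.
have yy : 0 < rip y y by rewrite rip_sqr exprn_gt0// rnorm_gt0.
have : 0 <= rip (rscale (rip y y) x - rscale (rip x y) y)
               (rscale (rip y y) x - rscale (rip x y) y).
  by rewrite rip_sqr sqr_ge0.
rewrite !ripE (ripC y x) => h.
rewrite -subr_ge0 -(pmulr_rge0 _ yy); apply: le_trans h _.
by rewrite le_eqVlt; apply/orP; left; apply/eqP; ring.
Qed.

Lemma cauchy_schwarz x y : `|rip x y| <= rnorm x * rnorm y.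
Proof.
rewrite -(@ler_pXn2r _ 2)// ?nnegrE ?mulr_ge0 ?rnorm_ge0//.
by rewrite real_normK ?num_real// exprMn -!rip_sqr cauchy_schwarz_sqr.
Qed.

Lemma parallelogram x y :
  rnorm (x + y) ^+ 2 + rnorm (x - y) ^+ 2 = 2 * (rnorm x ^+ 2 + rnorm y ^+ 2).
Proof. by rewrite -!rip_sqr !ripE (ripC y x); ring. Qed.

Section Convergence.
Context {T : Type} {F : set_system T} {FF : Filter F}.
Implicit Types f g : T -> H.

Lemma cvg_rnormP f x :
  f @ F --> x <-> (forall e : R, 0 < e -> \forall t \near F, rnorm (f t - x) < e).
Proof.
rewrite cvgrPdist_lt; split=> h e e0.
  have ec : 0 < e%:C by rewrite ltcR.
  by have := h _ ec; apply: filterS => t; rewrite norm_rnormE ltcR rnormBC.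
have [ec e'0] : e = (complex.Re e)%:C /\ 0 < complex.Re e.
  by move: e0; case: e => a b; rewrite ltcE /= => /andP[/eqP ->].
by have := h _ e'0; apply: filterS => t; rewrite ec norm_rnormE ltcR rnormBC.
Qed.

Lemma cvg_rnorm_le f x (b : T -> R) :
  (\forall t \near F, rnorm (f t - x) <= b t) -> b @ F --> (0 : R) ->
  f @ F --> x.
Proof.
move=> fb /cvgrPdist_lt b0; apply/cvg_rnormP => e e0; near=> t.
have : `|0 - b t| < e by near: t; exact: b0.
rewrite sub0r normrN; apply: le_lt_trans; apply: le_trans (ler_norm _).
by near: t.
Unshelve. all: by end_near. Qed.

Lemma cvg_rnorm_sub f x : f @ F --> x -> rnorm (f t - x) @[t --> F] --> (0 : R).
Proof.
move=> /cvg_rnormP h; apply/cvgrPdist_lt => e /h; apply: filterS => t.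
by rewrite sub0r normrN ger0_norm// rnorm_ge0.
Qed.

Lemma cvg_rip f g x y : f @ F --> x -> g @ F --> y ->
  rip (f t) (g t) @[t --> F] --> rip x y.
Proof.
move=> fx gy.
have f0 := cvg_rnorm_sub fx; have g0 := cvg_rnorm_sub gy.
have h : rnorm (f t - x) * rnorm (g t - y) + rnorm (f t - x) * rnorm y +
   rnorm x * rnorm (g t - y) @[t --> F] --> (0 : R).
  rewrite (_ : 0 = 0 * 0 + 0 * rnorm y + rnorm x * 0); last by ring.
  by apply: cvgD; [apply: cvgD; apply: cvgM|apply: cvgM] => //; exact: cvg_cst.
apply/cvgrPdist_lt => e e0; move/cvgrPdist_lt : h => /(_ _ e0).
apply: filterS => t; rewrite sub0r normrN; apply: le_lt_trans.
apply: le_trans (ler_norm _).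
rewrite distrC (_ : rip (f t) (g t) - rip x y = rip (f t - x) (g t - y) +
   rip (f t - x) y + rip x (g t - y)); last by rewrite !ripE; ring.
by do 2?[apply: le_trans (ler_normD _ _) _; apply: lerD]; exact: cauchy_schwarz.
Qed.

Lemma cvg_rnorm f x : f @ F --> x -> rnorm (f t) @[t --> F] --> rnorm x.
Proof.
move=> fx; have := cvg_comp _ _ (cvg_rip fx fx) (@sqrt_continuous R (rip x x)).
rewrite /comp.
have E z : Num.sqrt (rip z z) = rnorm z by rewrite rip_sqr sqrtr_sqr ger0_norm// rnorm_ge0.
by rewrite E; under eq_cvg do rewrite E.
Qed.

End Convergence.

Lemma rnorm_complete (u : nat -> H) :
  (forall e : R, 0 < e -> exists N, forall m n, (N <= m)%N -> (N <= n)%N ->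
     rnorm (u m - u n) < e) -> exists x, u @ \oo --> x.
Proof.
move=> cu; suff : cvg (u @ \oo) by move=> h; exists (lim (u @ \oo)).
apply: cauchy_cvg; apply/cauchy_ballP => e e0 /=.
have [ec e'0] : e = (complex.Re e)%:C /\ 0 < complex.Re e.
  by move: e0; case: e => a b; rewrite ltcE /= => /andP[/eqP ->].
have [N hN] := cu _ e'0.
exists (u @` [set n | (N <= n)%N], u @` [set n | (N <= n)%N]) => /=.
  by split; exists N => // n /= Nn; exists n.
move=> [x y] /= [[m Nm <-] [n Nn <-]].
by rewrite -ball_normE /ball_ /= ec norm_rnormE ltcR; exact: hN.
Qed.

End RealInner.

(** * Projection, Riesz and Lax-Milgram theorems *)
Section HilbertTheory.
Context {R : realType} {H : hilbertType R}.
Implicit Types (x y z : H) (r s : R).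

Lemma rip_eq x y : (forall z, rip x z = rip y z) -> x = y.
Proof.
move=> xy; apply/eqP; rewrite -subr_eq0 -rnorm_eq0 -sqrf_eq0 -rip_sqr.
by rewrite ripBl xy subrr.
Qed.

Lemma rnorm_cvg_unique (T : Type) (F : set_system T) (FF : ProperFilter F)
  (f : T -> H) x y : f @ F --> x -> f @ F --> y -> x = y.
Proof. by apply: cvg_unique; exact: norm_hausdorff. Qed.

Lemma cvg_rnorm_cauchy (u : nat -> H) x : u @ \oo --> x ->
  forall e : R, 0 < e -> exists N, forall m n, (N <= m)%N -> (N <= n)%N ->
    rnorm (u m - u n) < e.
Proof.
move=> /cvg_rnormP ux e e0; have [N _ hN] := ux _ (divr_gt0 e0 (ltr0Sn _ 1)).
exists N => m n Nm Nn; apply: le_lt_trans (rnorm_distD x _ _) _.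
by rewrite (splitr e) (rnormBC x) ltrD//; apply: hN.
Qed.

Definition subspace (E : set H) : Prop :=
  E 0 /\ forall r x y, E x -> E y -> E (x + rscale r y).

Lemma subspace_proj (E : set H) (f : H) : subspace E ->
  exists p (e : nat -> H), [/\ forall n, E (e n), e @ \oo --> p &
    forall y, E y -> rip (f - p) y = 0].
Proof.
move=> [E0 El]; pose S := [set rnorm (f - e) ^+ 2 | e in E].
have hS : has_inf S.
  split; first by exists (rnorm (f - 0) ^+ 2), 0.
  by exists 0 => _ [e _ <-]; exact: sqr_ge0.
have dE e : E e -> inf S <= rnorm (f - e) ^+ 2.
  by move=> Ee; apply: ge_inf; [case: hS|exists e].
have /choice [e he] n : exists e, E e /\ rnorm (f - e) ^+ 2 < inf S + n.+1%:R^-1.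
  have n0 : 0 < n.+1%:R^-1 :> R by rewrite invr_gt0.
  have [_ [e Ee <-] lt] := inf_adherent n0 hS.
  by exists e.
have cau m n : rnorm (e m - e n) ^+ 2 <= 2 * (m.+1%:R^-1 + n.+1%:R^-1).
  have [Em lem] := he m; have [En len] := he n.
  have := parallelogram (f - e m) (f - e n).
  have -> : f - e m - (f - e n) = - (e m - e n).
    by rewrite !opprB addrC addrA subrK.
  rewrite rnormN.
  have -> : f - e m + (f - e n) = rscale 2 (f - (rscale 2^-1 (e m) + rscale 2^-1 (e n))).
    rewrite rscaleBr rscaleDr !rscaleA divff// !rscale1 opprD.
    have -> : rscale 2 f = f + f.
      by rewrite /rscale [X in X *: _](_ : _ = 1 + 1) ?scalerDl ?scale1r// -(rmorphD (real_complex R)).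
    by rewrite addrACA.
  rewrite rnormZ ger0_norm// exprMn.
  have : inf S <= rnorm (f - (rscale 2^-1 (e m) + rscale 2^-1 (e n))) ^+ 2.
    apply: dE; apply: (El) => //.
    by rewrite -[rscale _ _]add0r; apply: El.
  move: lem len; move: (_^-1) (_^-1) => im jn; lra.
have [p ep] : exists p : H, e @ \oo --> p.
  apply: rnorm_complete => d d0.
  have d4 : 0 < d ^+ 2 / 4 by rewrite divr_gt0// exprn_gt0.
  have [N _ hN] := near_infty_natSinv_lt (PosNum d4).
  exists N => m n Nm Nn.
  rewrite -(@ltr_pXn2r _ 2)// ?nnegrE ?rnorm_ge0 ?ltW//.
  apply: le_lt_trans (cau _ _) _.
  have /= := hN _ Nm; have /= := hN _ Nn.
  move: (m.+1%:R^-1) (n.+1%:R^-1) => im jn; lra.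
exists p, e; split=> [n||y Ey]; [by have [] := he n|exact: ep|].
have key t : 2 * t * rip (f - p) y <= t ^+ 2 * rnorm y ^+ 2.
  have l1 : 2 * t * rip (f - e n) y @[n --> \oo] --> 2 * t * rip (f - p) y.
    apply: cvgM; first exact: cvg_cst.
    apply: cvg_rip; last exact: cvg_cst.
    by apply: cvgB => //; exact: cvg_cst.
  have l2 : harmonic n + t ^+ 2 * rnorm y ^+ 2 @[n --> \oo] --> 0 + t ^+ 2 * rnorm y ^+ 2.
    by apply: cvgD; [exact: cvg_harmonic|exact: cvg_cst].
  rewrite add0r in l2.
  apply: ler_cvg_to l1 l2 _; near=> n.
  have [En len] := he n.
  have := dE _ (El t _ _ En Ey).
  move: len; rewrite opprD addrA -!rip_sqr !ripE (ripC y f) (ripC y (e n)) /=.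
  by move: (_^-1) => jn; lra.
have [->|y0] := eqVneq y 0; first by rewrite rip0r.
have := key (rip (f - p) y / rnorm y ^+ 2).
have ny : rnorm y ^+ 2 != 0 by rewrite sqrf_eq0 rnorm_eq0.
set r := rip _ _; have -> : 2 * (r / rnorm y ^+ 2) * r = 2 * (r ^+ 2 / rnorm y ^+ 2) by ring.
have -> : (r / rnorm y ^+ 2) ^+ 2 * rnorm y ^+ 2 = r ^+ 2 / rnorm y ^+ 2 by field; rewrite rnorm_eq0.
have : 0 <= r ^+ 2 / rnorm y ^+ 2 by rewrite divr_ge0// sqr_ge0.
move=> h1 h2; have : r ^+ 2 / rnorm y ^+ 2 = 0 by lra.
by move/eqP; rewrite mulf_eq0 invr_eq0 (negbTE ny) orbF sqrf_eq0 => /eqP.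
Unshelve. all: by end_near. Qed.

Definition real_linear (f : H -> R) : Prop :=
  forall r x y, f (x + rscale r y) = f x + r * f y.

Lemma real_linear0 f : real_linear f -> f 0 = 0.
Proof. by move=> /(_ 1 0 0); rewrite rscale1 addr0 mul1r => /eqP; rewrite -subr_eq0 opprD addNKr oppr_eq0 => /eqP. Qed.

Lemma riesz (f : H -> R) (C : R) : real_linear f ->
  (forall x, `|f x| <= C * rnorm x) -> exists w, forall x, f x = rip w x.
Proof.
move=> fl fC; have f0 := real_linear0 fl.
have [h|/existsNP [g /eqP fg]] := pselect (forall x, f x = 0).
  by exists 0 => x; rewrite h rip0l.
have [|p [e [Ee ep orth]]] := @subspace_proj [set x | f x = 0] g.
  by split=> // r x y /= fx fy; rewrite fl fx fy mulr0 addr0.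
have fB x y : f (x - y) = f x - f y.
  by have := fl (-1) x y; rewrite rscaleNl rscale1 mulN1r.
have fp : f p = 0.
  apply/eqP; rewrite -normr_le0 -(mulr0 C).
  have l : C * rnorm (e n - p) @[n --> \oo] --> C * 0.
    by apply: cvgM; [exact: cvg_cst|exact: cvg_rnorm_sub].
  apply: (ler_cvg_to (cvg_cst _) l); near=> n.
  by apply: le_trans (fC _); rewrite fB Ee sub0r normrN.
pose z := g - p; have fz : f z = f g by rewrite fB fp subr0.
have zz : rip z z != 0.
  rewrite rip_sqr sqrf_eq0 rnorm_eq0; apply/eqP => z0.
  by move: fg; rewrite -fz z0 f0 eqxx.
exists (rscale (f z / rip z z) z) => x.
have := orth (x + rscale (- (f x / f z)) z).
rewrite /= fl mulNr divfK ?fz// subrr => /(_ erefl).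
rewrite -/z ripDr ripZr -fz ripZl => h.
have -> : rip z x = f x / f z * rip z z by apply/eqP; rewrite -subr_eq0 -mulNr h.
by field; rewrite zz fz fg.
Unshelve. all: by end_near. Qed.

Lemma real_lax_milgram (b : H -> H -> R) (C c : R) :
  (forall y, real_linear (b^~ y)) -> (forall x, real_linear (b x)) ->
  (forall x y, `|b x y| <= C * rnorm x * rnorm y) ->
  0 < c -> (forall x, c * rnorm x ^+ 2 <= b x x) ->
  forall (f : H -> R) (D : R), real_linear f -> (forall x, `|f x| <= D * rnorm x) ->
  exists u, forall v, b u v = f v.
Proof.
move=> bl br bC c0 bc f D fl fD.
have /choice [B hB] u : exists w, forall v, b u v = rip w v.
  by apply: (riesz (C := C * rnorm u)) => // v; exact: bC.
have [g hg] := riesz fl fD.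
have Bl r x y : B (x + rscale r y) = B x + rscale r (B y).
  by apply: rip_eq => z; rewrite -hB bl !hB ripDl ripZl.
have BB x y : B (x - y) = B x - B y.
  by have := Bl (-1) x y; rewrite !rscaleNl !rscale1.
have Bc x : c * rnorm x <= rnorm (B x).
  have [->|x0] := eqVneq x 0; first by rewrite rnorm0 mulr0 rnorm_ge0.
  have nx : 0 < rnorm x by rewrite rnorm_gt0.
  rewrite -(ler_pM2r nx) -mulrA -expr2; apply: le_trans (bc x) _.
  by rewrite hB; apply: le_trans (ler_norm _) _; exact: cauchy_schwarz.
have [|p [e [Ee ep orth]]] := @subspace_proj (range B) g.
  split; first by exists 0 => //; rewrite -(subrr 0) BB !subrr.
  by move=> r _ _ [x _ <-] [y _ <-]; exists (x + rscale r y).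
have /choice [u hu] n : exists u, B u = e n by have [u _ <-] := Ee n; exists u.
have [v uv] : exists v : H, u @ \oo --> v.
  apply: rnorm_complete => d d0.
  have [N hN] := cvg_rnorm_cauchy ep (mulr_gt0 c0 d0).
  exists N => m n Nm Nn; rewrite -(ltr_pM2l c0).
  by apply: le_lt_trans (Bc _) _; rewrite BB !hu hN.
have Bv : B v = p.
  apply: (@rnorm_cvg_unique _ \oo _ e) => //.
  have l : C * rnorm (u n - v) @[n --> \oo] --> (0 : R).
    rewrite -(mulr0 C); apply: cvgM; [exact: cvg_cst|exact: cvg_rnorm_sub].
  apply: (cvg_rnorm_le _ l); near=> n; rewrite -hu -BB.
  have := bC (u n - v) (B (u n - v)); rewrite hB rip_sqr => h.
  have [->|w0] := eqVneq (rnorm (B (u n - v))) 0.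
    have : 0 <= C * rnorm (u n - v) * rnorm (u n - v).
      by apply: le_trans (bC _ _).
    have := rnorm_ge0 (u n - v); rewrite le_eqVlt => /orP[/eqP <-|nu].
      by rewrite !mulr0.
    by rewrite pmulr_lge0.
  have w1 : 0 < rnorm (B (u n - v)) by rewrite lt_def w0 rnorm_ge0.
  by rewrite -(ler_pM2r w1) -expr2; apply: le_trans h; exact: ler_norm.
have gp : g - p = 0.
  apply/eqP; rewrite -rnorm_eq0 -sqrf_eq0.
  have := bc (g - p); rewrite hB ripC orth; last by exists (g - p).
  by move=> h; rewrite eq_le sqr_ge0 andbT -(pmulr_rle0 _ c0).
exists v => w; rewrite hB Bv hg; congr (rip _ w).
by apply/esym/eqP; rewrite -subr_eq0 gp.
Unshelve. all: by end_near. Qed.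

End HilbertTheory.

(* What is left of the form once V is forgotten. The field [sect_square] comes
   from |Ax|^2 = a(x, Ax) <= C |x|_V |Ax|_V by completing the square. *)
Record sectorial {R : realType} {H : hilbertType R} (A : operator H) (c K : R) : Prop := {
  sect_linear : forall r x y, dom A x -> dom A y ->
    dom A (x + rscale r y) /\ A (x + rscale r y) = A x + rscale r (A y) ;
  sect_c_gt0 : 0 < c ;
  sect_coercive : forall x, dom A x -> c * rnorm x ^+ 2 <= rip (A x) x ;
  sect_K_gt0 : 0 < K ;
  sect_square : forall x t, dom A x -> dom A (A x) -> 0 <= t ->
    t * rnorm (A x) ^+ 2 <= t ^+ 2 * rip (A (A x)) (A x) + K ^+ 2 * rip (A x) x ;
  sect_surjective : forall f, exists2 x, dom A x & A x = f ;
  sect_dense : forall x e, 0 < e -> exists2 y, dom A y & rnorm (x - y) < e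
}.

Section LaxMilgram.
Context {R : realType} {V H : hilbertType R}.
Variables (j : {linear V -> H}) (a : sesquilinear_form V).
Hypotheses (hj : dense_embedding j) (bnd_a : bounded_form a) (ell_a : elliptic_form a).
Local Open Scope complex_scope.

Lemma linear_real r u v : j (u + rscale r v) = j u + rscale r (j v).
Proof. by rewrite linearD linearZ. Qed.

Lemma embedding_bounded : exists2 C : R, 0 < C & forall v, rnorm (j v) <= C * rnorm v.
Proof.
have /cvg_rnormP /(_ 1 ltr01) /nbhs_ballP [d d0 hd] := @embedding_continuous _ _ _ _ hj 0.
have [dc d'0] : d = (complex.Re d)%:C /\ 0 < complex.Re d.
  by move: d0; case: d {hd} => x y /=; rewrite ltcE /= => /andP[/eqP ->].
set r := complex.Re d in dc d'0.
exists (2 / r) => [|v]; first by rewrite divr_gt0.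
have [->|v0] := eqVneq v 0; first by rewrite linear0 !rnorm0 mulr0.
have nv : 0 < rnorm v by rewrite rnorm_gt0.
pose s := r / (2 * rnorm v).
have s0 : 0 < s by rewrite divr_gt0// mulr_gt0.
have := hd (rscale s v).
rewrite -ball_normE /ball_ /= sub0r normrN linear0 subr0 dc norm_rnormE ltcR.
rewrite rnormZ gtr0_norm// /s.
have -> : r / (2 * rnorm v) * rnorm v = r / 2 by field; rewrite gt_eqF.
have -> : j (rscale s v) = rscale s (j v) by rewrite /rscale linearZ.
rewrite rnormZ gtr0_norm// => h.
have lt1 : s * rnorm (j v) < 1 by apply: h; lra.
rewrite -(ler_pM2l s0); apply: ltW; apply: lt_le_trans lt1 _.
by rewrite le_eqVlt; apply/orP; left; apply/eqP; rewrite /s; field; rewrite !gt_eqF.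
Qed.

Lemma embedding_total x : (forall v, rip x (j v) = 0) -> x = 0.
Proof.
move=> h; apply/eqP; rewrite -rnorm_eq0; apply: contraT => nx0.
have nx : 0 < rnorm x by rewrite lt_def nx0 rnorm_ge0.
have nxc : 0 < (rnorm x)%:C by rewrite ltcR.
have [||y [xy [v _ vy]]] := embedding_dense hj (O := ball x (rnorm x)%:C).
- by exists x; exact: ballxx.
- exact: ball_open.
have {}xy : rnorm (x - j v) < rnorm x.
  by rewrite vy; move: xy; rewrite -ball_normE /ball_ /= norm_rnormE ltcR.
have : rnorm x ^+ 2 <= rnorm x * rnorm (x - j v).
  rewrite -rip_sqr -[X in X <= _](_ : rip x (x - j v) = _); last by rewrite ripBr h subr0.
  exact: le_trans (ler_norm _) (cauchy_schwarz _ _).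
by rewrite expr2 ler_pM2l// leNgt xy.
Qed.

Lemma lax_milgram_at_unique x f g :
  lax_milgram_at j a x f -> lax_milgram_at j a x g -> f = g.
Proof.
move=> [u <- hf] [v /(embedding_inj hj) -> hg]; apply/eqP; rewrite -subr_eq0.
apply/eqP/embedding_total => w; rewrite ripBl /rip.
have := hf w; have := hg w; rewrite /form_operator /to_antidual => <- <-.
by rewrite subrr.
Qed.

Lemma lax_milgramP x f :
  lax_milgram_at j a x f <-> dom (lax_milgram j a) x /\ lax_milgram j a x = f.
Proof.
split=> [h|[[g hg] <-]] /=; last exact: xgetI hg.
have d : dom (lax_milgram j a) x by exists f.
by split=> //; apply: (@lax_milgram_at_unique x) => //; exact: xgetI h.
Qed.

Lemma sesqui_realDl r u u' v :
  complex.Re (a (u + rscale r u') v) = complex.Re (a u v) + r * complex.Re (a u' v).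
Proof. by rewrite linearDl linearZl_LR ReD ReZ. Qed.

Lemma sesqui_realDr r u v v' :
  complex.Re (a u (v + rscale r v')) = complex.Re (a u v) + r * complex.Re (a u v').
Proof. by rewrite linearDr linearZr_LR /= conjC_real ReD ReZ. Qed.

Lemma lax_milgram_surjective f :
  exists2 x, dom (lax_milgram j a) x & lax_milgram j a x = f.
Proof.
have [C C0 hC] := bnd_a; have [c c0 hc] := ell_a.
have [D D0 hD] := embedding_bounded.
have hRe (z : R[i]) : `|complex.Re z| <= complex.Re `|z|.
  by have := normc_ge_Re z; rewrite lecE => /andP[].
have [|||||u hu] := @real_lax_milgram R V (fun u v => complex.Re (a u v)) C c _ _ _ c0 hc
    (fun v => rip f (j v)) (rnorm f * D).
- by move=> v r u u'; exact: sesqui_realDl.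
- by move=> u r v v'; exact: sesqui_realDr.
- by move=> u v; apply: le_trans (hRe _) (hC _ _).
- by move=> r v v'; rewrite linear_real ripDr ripZr.
- move=> v; apply: le_trans (cauchy_schwarz _ _) _.
  by rewrite -mulrA ler_wpM2l ?rnorm_ge0.
suff /lax_milgramP[] : lax_milgram_at j a (j u) f by exists (j u).
exists u => // v; rewrite /form_operator /to_antidual; apply/eqP.
rewrite eq_complex -[complex.Re (inner _ _)]/(rip f (j v)) -hu eqxx /=.
have := hu ('i%C *: v).
have -> : j ('i%C *: v) = 'i%C *: j v by rewrite linearZ.
rewrite /rip !linearZr_LR /=.
by case: (a u v) => x y; case: (inner f (j v)) => x' y' /=; rewrite !mul0r !sub0r !mulN1r !opprK => ->.
Qed.

Lemma lax_milgram_linear r x y : let A := lax_milgram j a in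
  dom A x -> dom A y ->
  dom A (x + rscale r y) /\ A (x + rscale r y) = A x + rscale r (A y).
Proof.
move=> A dx dy; apply/lax_milgramP.
have /lax_milgramP[u ux hu] : dom A x /\ A x = A x by [].
have /lax_milgramP[v vy hv] : dom A y /\ A y = A y by [].
exists (u + rscale r v) => [|w]; first by rewrite linear_real ux vy.
have := hu w; have := hv w; rewrite /form_operator /to_antidual => hvw huw.
by rewrite !linearDl !linearZl_LR hvw huw.
Qed.

Lemma lax_milgram_sectorial : exists c K : R, sectorial (lax_milgram j a) c K.
Proof.
have [C C0 hC] := bnd_a; have [c c0 hc] := ell_a.
have [D D0 hD] := embedding_bounded.
have surj := lax_milgram_surjective.
set A := lax_milgram j a in surj *.
have lin : forall r x y, dom A x -> dom A y ->
  dom A (x + rscale r y) /\ A (x + rscale r y) = A x + rscale r (A y).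
  by move=> r x y; exact: lax_milgram_linear.
have hRe (z : R[i]) : complex.Re z <= complex.Re `|z|.
  by have := normc_ge_Re z; rewrite lecE => /andP[_]; apply: le_trans; exact: ler_norm.
have cD0 : 0 < c / D ^+ 2 by rewrite divr_gt0// exprn_gt0.
have coer x : dom A x -> c / D ^+ 2 * rnorm x ^+ 2 <= rip (A x) x.
  move=> dx; have /lax_milgramP[u <- hu] : dom A x /\ A x = A x by [].
  apply: (@le_trans _ _ (c * rnorm u ^+ 2)).
    rewrite -mulrA ler_pM2l// mulrC ler_pdivrMr ?exprn_gt0// -exprMn mulrC.
    by rewrite ler_pXn2r// ?nnegrE ?mulr_ge0 ?rnorm_ge0// ltW.
  by apply: le_trans (hc u) _; have := hu u; rewrite /form_operator /to_antidual /rip => ->.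
have A0 : A 0 = 0.
  have [x dx _] := surj 0.
  by have [_] := lin (-1) _ _ dx dx; rewrite !rscaleNl !rscale1 !subrr.
exists (c / D ^+ 2), (C / (2 * c)); split=> //.
- by rewrite divr_gt0// mulr_gt0.
- move=> x t dx dAx t0.
  have /lax_milgramP[u ux hu] : dom A x /\ A x = A x by [].
  have /lax_milgramP[p pAx hp] : dom A (A x) /\ A (A x) = A (A x) by [].
  have e1 : rnorm (A x) ^+ 2 <= C * rnorm u * rnorm p.
    rewrite -rip_sqr -{2}pAx /rip; have := hu p.
    by rewrite /form_operator /to_antidual => <-; apply: le_trans (hRe _) (hC _ _).
  have e2 : c * rnorm u ^+ 2 <= rip (A x) x.
    by apply: le_trans (hc u) _; have := hu u; rewrite /form_operator /to_antidual /rip ux => ->.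
  have e3 : c * rnorm p ^+ 2 <= rip (A (A x)) (A x).
    by apply: le_trans (hc p) _; have := hp p; rewrite /form_operator /to_antidual /rip pAx => ->.
  apply: (@le_trans _ _ (t * (C * rnorm u * rnorm p))); first by rewrite ler_wpM2l.
  apply: (@le_trans _ _ (t ^+ 2 * (c * rnorm p ^+ 2) + (C / (2 * c)) ^+ 2 * (c * rnorm u ^+ 2))); last first.
    by apply: lerD; rewrite ler_wpM2l// sqr_ge0.
  rewrite -subr_ge0.
  rewrite (_ : _ - _ = c * (t * rnorm p - C / (2 * c) * rnorm u) ^+ 2).
    by rewrite mulr_ge0 ?sqr_ge0 ?ltW.
  by field; rewrite gt_eqF.
move=> f e e0.
have [|p [y [Ey yp orth]]] := @subspace_proj _ _ (dom A) f.
  have [x dx _] := surj 0; split=> [|r y z dy dz].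
    by have [+ _] := lin (-1) _ _ dx dx; rewrite rscaleNl rscale1 subrr.
  by have [] := lin r _ _ dy dz.
have [x dx xE] := surj (f - p).
have x0 : x = 0.
  apply/eqP; rewrite -rnorm_eq0 -sqrf_eq0.
  have := coer _ dx; rewrite xE orth// pmulr_rle0// => h.
  by rewrite eq_le h sqr_ge0.
have fp : f = p by apply/eqP; rewrite -subr_eq0 -xE x0 A0.
move/cvg_rnormP : yp => /(_ _ e0) [N _ hN].
by exists (y N) => //; rewrite fp rnormBC; apply: hN => /=.
Qed.

End LaxMilgram.

(** * Derivatives *)
Section RealLemmas.
Context {R : realType}.

Lemma cvg_normr0 : `|s| @[s --> (0:R)^'] --> (0:R)^'+.
Proof.
move=> P /nbhs_ballP [e /= e0 he]; apply/nbhs_ballP; exists e => //= s.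
rewrite /ball /= !sub0r !normrN => se s0; apply: he; last by rewrite normr_gt0.
by rewrite /ball /= sub0r normrN normr_id.
Qed.

Lemma is_derive_quotient (f : R -> R) (t l : R) :
  s^-1 * (f (t + s) - f t) @[s --> 0^'] --> l -> is_derive t 1 f l.
Proof.
move=> h.
have h' : (fun h : R => h^-1 *: ((f \o shift t) (h *: 1) - f t)) @ 0^' --> l.
  apply: cvg_trans h; apply: near_eq_cvg; near=> s.
  by rewrite /= [t + s]addrC /GRing.scale /= mulr1.
by apply: DeriveDef; [exact: (cvgP l)|exact: cvg_lim].
Unshelve. all: by end_near. Qed.

Lemma is_derive_eqfun (f g : R -> R) (t l l' : R) :
  is_derive t 1 f l -> f =1 g -> l = l' -> is_derive t 1 g l'.
Proof. by move=> h /funext <- <-. Qed.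

Lemma is_derive_continuous (f : R -> R) (t l : R) :
  is_derive t 1 f l -> {for t, continuous f}.
Proof. by move=> [df _]; exact/differentiable_continuous/derivable1_diffP. Qed.

Lemma MVT_right (f df : R -> R) (a b : R) : a < b ->
  (forall t, a < t -> t <= b -> is_derive t 1 f (df t)) ->
  f x @[x --> a^'+] --> f a ->
  exists xi, [/\ a < xi, xi < b & f b - f a = df xi * (b - a)].
Proof.
move=> ab fd fa.
have fc t : a < t -> t <= b -> {for t, continuous f}.
  by move=> at_ tb; exact: is_derive_continuous (fd _ at_ tb).
have [||xi] := @MVT _ f df a b ab.
- by move=> t; rewrite in_itv /= => /andP[at_ tb]; apply: fd => //; exact: ltW.
- apply/continuous_within_itvP => //; split=> //.
    by move=> t; rewrite in_itv /= => /andP[at_ tb]; apply: fc => //; exact: ltW.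
  exact: cvg_at_left_filter (fc b ab (lexx b)).
by rewrite in_itv /= => /andP[? ?] ?; exists xi.
Qed.

End RealLemmas.

Section HilbertDerivative.
Context {R : realType} {H : hilbertType R}.
Implicit Types (u w : R -> H) (t : R).

Definition has_deriv u t (l : H) : Prop :=
  rscale s^-1 (u (t + s) - u t) @[s --> 0^'] --> l.

Lemma has_deriv_cvg u t l : has_deriv u t l -> u (t + s) @[s --> 0^'] --> u t.
Proof.
move=> ul; apply: (@cvg_rnorm_le _ _ _ _ _ _ _ (fun s => `|s| * rnorm (rscale s^-1 (u (t + s) - u t)))).
  near=> s; have s0 : s != 0 by near: s; exact: nbhs_dnbhs_neq.
  by rewrite -rnormZ rscaleA divff// rscale1.
have a0 : `|s| @[s --> (0 : R)^'] --> (0 : R) by apply: cvg_trans cvg_normr0 _; exact: cvg_within.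
by have h := cvgM a0 (cvg_rnorm ul); rewrite mul0r in h; exact: h.
Unshelve. all: by end_near. Qed.

Lemma is_derive_rip u w t lu lw : has_deriv u t lu -> has_deriv w t lw ->
  is_derive t 1 (fun s => rip (u s) (w s)) (rip lu (w t) + rip (u t) lw).
Proof.
move=> du dw; apply: is_derive_quotient.
have : rip (rscale s^-1 (u (t + s) - u t)) (w (t + s)) +
       rip (u t) (rscale s^-1 (w (t + s) - w t)) @[s --> 0^'] -->
       rip lu (w t) + rip (u t) lw.
  apply: cvgD; apply: cvg_rip => //; first exact: has_deriv_cvg dw.
  exact: cvg_cst.
apply: cvg_trans; apply: near_eq_cvg; near=> s.
by rewrite !ripZl !ripZr ripBl ripBr; ring.
Unshelve. all: by end_near. Qed.

Lemma has_deriv_cst x t : has_deriv (fun _ => x) t 0.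
Proof.
rewrite /has_deriv; under eq_fun do rewrite subrr.
apply: (@cvg_trans _ (cst 0 @ 0^')); last exact: cvg_cst.
by apply: near_eq_cvg; near=> s; rewrite /= /rscale scaler0.
Unshelve. all: by end_near. Qed.

End HilbertDerivative.

(** * Contraction and smoothing *)
Section Semigroup.
Context {R : realType} {H : hilbertType R}.
Variables (A : operator H) (c K : R) (T : R -> H -> H).
Hypotheses (secA : sectorial A c K) (semi : C0_semigroup T)
  (gen : is_generator (opp_operator A) T).
Implicit Types (x y : H) (t s : R).

Lemma sg_linear t r x y : 0 <= t -> T t (x + rscale r y) = T t x + rscale r (T t y).
Proof. by move=> t0; rewrite addrC (C0_linear semi t0) addrC. Qed.

Lemma sg0 t : 0 <= t -> T t 0 = 0.
Proof.
move=> t0; have := sg_linear 1 0 0 t0; rewrite !rscale1 addr0.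
by move/eqP; rewrite -subr_eq0 opprD addNKr oppr_eq0 => /eqP.
Qed.

Lemma sgZ t r x : 0 <= t -> T t (rscale r x) = rscale r (T t x).
Proof. by move=> t0; have := sg_linear r 0 x t0; rewrite !add0r sg0// add0r. Qed.

Lemma sgD t x y : 0 <= t -> T t (x + y) = T t x + T t y.
Proof. by move=> t0; have := sg_linear 1 x y t0; rewrite !rscale1. Qed.

Lemma sgB t x y : 0 <= t -> T t (x - y) = T t x - T t y.
Proof. by move=> t0; have := sg_linear (-1) x y t0; rewrite !rscaleNl !rscale1. Qed.

Lemma sgN t x : 0 <= t -> T t (- x) = - T t x.
Proof. by move=> t0; rewrite -sub0r sgB// sg0// sub0r. Qed.

Lemma sg_generator x : dom A x -> rscale s^-1 (T s x - x) @[s --> 0^'+] --> - A x.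
Proof. by move=> dx; apply/gen. Qed.

Lemma sg_commute t x : 0 <= t -> dom A x -> dom A (T t x) /\ A (T t x) = T t (A x).
Proof.
move=> t0 dx.
have h : rscale s^-1 (T s (T t x) - T t x) @[s --> 0^'+] --> T t (- A x).
  apply: cvg_trans (continuous_cvg _ (C0_continuous semi t0 (x := _)) (sg_generator dx)).
  apply: near_eq_cvg; near=> s; have s0 : 0 <= s by near: s; exact: nbhs_right_ge.
  by rewrite /= sgZ// sgB// -!(C0_add semi)// [t + s]addrC.
have [d e] : dom (opp_operator A) (T t x) /\ - A (T t x) = T t (- A x) by apply/gen.
by split=> //; apply: oppr_inj; rewrite e sgN.
Unshelve. all: by end_near. Qed.

(* Replaces the uniform boundedness principle: nested balls on which arbitrarily
   early operators [T t] are arbitrarily large. *)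
Lemma sg_escape x0 r n : (forall d M, 0 < d ->
    exists t x, [/\ 0 <= t, t < d & M * rnorm x < rnorm (T t x)]) -> 0 < r ->
  exists x1 r1 t, [/\ 0 < r1, r1 <= n.+1%:R^-1,
    forall y, rnorm (y - x1) <= r1 -> rnorm (y - x0) <= r,
    0 <= t < n.+1%:R^-1 &
    forall y, rnorm (y - x1) <= r1 -> n%:R <= rnorm (T t y)].
Proof.
move=> unb r0.
have n0 : 0 < n.+1%:R^-1 :> R by rewrite invr_gt0.
have [t [y [t0 tn hy]]] := unb _ (2 * n.+1%:R / r) n0.
have y0 : 0 < rnorm y.
  rewrite rnorm_gt0; apply: contraTneq hy => ->.
  by rewrite sg0// !rnorm0 mulr0 ltxx.
pose k := r / (2 * rnorm y); have k0 : 0 < k by rewrite divr_gt0// mulr_gt0.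
pose z := rscale k y.
have nz : rnorm z = r / 2.
  by rewrite rnormZ gtr0_norm// /k; field; rewrite gt_eqF.
have nTz : n.+1%:R < rnorm (T t z).
  rewrite sgZ// rnormZ gtr0_norm//; move: hy; rewrite -(ltr_pM2l k0); apply: le_lt_trans.
  by rewrite le_eqVlt; apply/orP; left; apply/eqP; rewrite /k; field; rewrite !gt_eqF.
have [x1 x1x0 hx1] : exists2 x1, rnorm (x1 - x0) = r / 2 & n.+1%:R < rnorm (T t x1).
  have [h|h] := ltP n.+1%:R (rnorm (T t (x0 + z))).
    by exists (x0 + z) => //; rewrite addrC addKr.
  exists (x0 - z); first by rewrite addrC addKr rnormN.
  rewrite ltNge; apply/negP => h'.
  have : rnorm (rscale 2 (T t z)) <= n.+1%:R + n.+1%:R.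
    rewrite (_ : rscale 2 _ = T t (x0 + z) - T t (x0 - z)).
      by apply: le_trans (rnormB _ _) _; exact: lerD.
    rewrite -sgB// opprD addrACA subrr add0r opprK -sgZ//; congr (T t _).
    by rewrite /rscale [X in X *: _](_ : _ = 1 + 1) ?scalerDl ?scale1r// -(rmorphD (real_complex R)).
  by rewrite rnormZ ger0_norm//; move: nTz; lra.
have /cvg_rnormP /(_ 1 ltr01) /nbhs_ballP [d d0 hd] := C0_continuous semi t0 (x := x1).
have [dc d'0] : d = ((complex.Re d)%:C)%C /\ 0 < complex.Re d.
  by move: d0; case: d {hd} => a b /=; rewrite ltcE /= => /andP[/eqP ->].
set e := complex.Re d in dc d'0.
exists x1, (Num.min (e / 2) (Num.min (r / 2) n.+1%:R^-1)), t; split => //.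
- by rewrite !lt_min n0 !divr_gt0.
- by rewrite !ge_min lexx !orbT.
- move=> y'; rewrite !le_min => /and3P[_ h _].
  by apply: le_trans (rnorm_distD x1 _ _) _; rewrite x1x0; move: h; lra.
- by rewrite t0.
- move=> y'; rewrite !le_min => /and3P[h _ _].
  have : rnorm (T t y' - T t x1) < 1.
    apply: hd; rewrite -ball_normE /ball_ /= dc norm_rnormE ltcR rnormBC.
    by apply: le_lt_trans h _; lra.
  have := rnorm_distD (T t y') (T t x1) 0; rewrite !subr0 rnormBC.
  by move: hx1; rewrite -natr1; lra.
Qed.

Lemma sg_locally_bounded : exists d M, [/\ 0 < d, 0 <= M &
  forall t x, 0 <= t -> t < d -> rnorm (T t x) <= M * rnorm x].
Proof.
apply: contrapT => nb.
have unb d M : 0 < d -> exists t x, [/\ 0 <= t, t < d & M * rnorm x < rnorm (T t x)].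
  move=> d0; apply: contrapT => h; apply: nb; exists d, (Num.max M 0).
  split=> // [|t x t0 td]; first by rewrite le_max lexx orbT.
  rewrite leNgt; apply/negP => lt; apply: h; exists t, x; split=> //.
  by apply: le_lt_trans lt; rewrite ler_wpM2r ?rnorm_ge0// le_max lexx.
have /choice [f hf] (p : (H * R) * nat) : exists q : H * R, 0 < p.1.2 ->
    [/\ 0 < q.2, q.2 <= p.2.+1%:R^-1,
     forall y, rnorm (y - q.1) <= q.2 -> rnorm (y - p.1.1) <= p.1.2 &
     exists t, [/\ 0 <= t, t < p.2.+1%:R^-1 &
       forall y, rnorm (y - q.1) <= q.2 -> p.2%:R <= rnorm (T t y)]].
  case: p => -[x0 r] n /=.
  have [r0|r0] := pselect (0 < r); last by exists (0, 0) => /r0.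
  have [x1 [r1 [t [r1_gt0 r1n sub /andP[t0 tn] ht]]]] := sg_escape x0 n unb r0.
  by exists (x1, r1) => _ /=; split=> //; exists t.
pose p := fix p n : H * R := if n is m.+1 then f (p m, m) else (0, 1).
have p0 n : 0 < (p n).2.
  by elim: n => [|n IH] //=; have [] := hf (p n, n) IH.
have nest m n y : (m <= n)%N -> rnorm (y - (p n).1) <= (p n).2 -> rnorm (y - (p m).1) <= (p m).2.
  elim: n => [|n IH]; first by rewrite leqn0 => /eqP ->.
  rewrite leq_eqVlt => /orP[/eqP -> //|mn] h; apply: IH => //.
  by have [_ _ + _] := hf (p n, n) (p0 n); apply.
have close m n : (m <= n)%N -> rnorm ((p n).1 - (p m).1) <= (p m).2.
  by move=> mn; apply: (nest m n) => //; rewrite subrr rnorm0 ltW.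
have [x px] : exists x : H, (p n).1 @[n --> \oo] --> x.
  apply: rnorm_complete => e e0.
  have [N _ hN] := near_infty_natSinv_lt (PosNum (divr_gt0 e0 (ltr0Sn _ 1))).
  exists N.+1 => m n Nm Nn.
  apply: le_lt_trans (rnorm_distD (p N.+1).1 _ _) _.
  have := close _ _ Nm; have := close _ _ Nn; rewrite (rnormBC (p n).1).
  have [_ + _ _] := hf (p N, N) (p0 N); have /= := hN _ (leqnn N).
  by move: (N.+1%:R^-1) => k; rewrite -/(p N.+1) /=; lra.
have xin n : rnorm (x - (p n).1) <= (p n).2.
  have l : rnorm ((p m).1 - (p n).1) @[m --> \oo] --> rnorm (x - (p n).1).
    by apply: cvg_rnorm; apply: cvgB => //; exact: cvg_cst.
  apply: (ler_cvg_to l (cvg_cst _)); near=> m; apply: close.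
  by near: m; exact: nbhs_infty_ge.
have /cvg_rnormP /(_ 1 ltr01) /nbhs_ballP [d /= d0 hd] := @C0_strong _ _ _ semi x.
have [N _ hN] := near_infty_natSinv_lt (PosNum d0).
have [N' _ hN'] := nbhs_infty_ger (rnorm x + 2).
pose n := maxn N N'.
have [_ _ _ [t [t0 tn ht]]] := hf (p n, n) (p0 n).
have lt1 : rnorm (T t x - x) < 1.
  move: t0; rewrite le_eqVlt => /orP[/eqP <-|t0].
    by rewrite (C0_0 semi) subrr rnorm0.
  apply: hd => //; rewrite /ball /= sub0r normrN gtr0_norm//.
  by apply: lt_trans tn _; apply: (hN n); exact: leq_maxl.
have := ht x (xin n.+1); have := hN' n (leq_maxr _ _) => /=.
have := rnorm_distD x (T t x) 0; rewrite !subr0; lra.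
Unshelve. all: by end_near. Qed.

Section Bounded.
Variables (b M : R).
Hypotheses (M0 : 0 <= M)
  (bndT : forall t x, 0 <= t -> t < b -> rnorm (T t x) <= M * rnorm x).

Lemma sg_deriv_bounded t y : 0 < t -> t < b -> dom A y ->
  has_deriv (fun s => T s y) t (- T t (A y)).
Proof.
move=> t0 tb dy.
pose g1 s := rnorm (rscale s^-1 (T s y - y) - - A y).
pose g2 s := rnorm (T s (A y) - A y).
have g0 : M * (g1 `|s| + g2 `|s|) @[s --> (0:R)^'] --> (0 : R).
  have h1 : g1 s @[s --> 0^'+] --> (0 : R) by exact: cvg_rnorm_sub (sg_generator dy).
  have h2 : g2 s @[s --> 0^'+] --> (0 : R) by exact: cvg_rnorm_sub (@C0_strong _ _ _ semi (A y)).
  have h := cvgM (cvg_cst M)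
    (cvgD (cvg_comp _ _ cvg_normr0 h1) (cvg_comp _ _ cvg_normr0 h2)).
  by rewrite addr0 mulr0 in h; exact: h.
have m0 : 0 < Num.min t (b - t) by rewrite lt_min t0 subr_gt0.
apply: (cvg_rnorm_le _ g0); near=> s.
have s0 : s != 0 by near: s; exact: nbhs_dnbhs_neq.
have [st sb] : `|s| < t /\ `|s| < b - t.
  have : `|s| < Num.min t (b - t).
    by near: s; exact: dnbhs0_lt m0.
  by rewrite lt_min => /andP.
have g2_ge0 : 0 <= g2 `|s| by exact: rnorm_ge0.
have [s_gt|s_lt] : 0 < s \/ s < 0.
  by move: s0; rewrite neq_lt => /orP[]; [right|left].
- rewrite gtr0_norm// in st sb g2_ge0 *.
  have -> : rscale s^-1 (T (t + s) y - T t y) - - T t (A y) =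
      T t (rscale s^-1 (T s y - y) - - A y).
    by rewrite !opprK sgD ?sgZ ?sgB -?(C0_add semi) ?ltW.
  apply: le_trans (bndT _ (ltW t0) tb) _.
  by rewrite ler_wpM2l// lerDl.
- rewrite ltr0_norm// in st sb g2_ge0 *.
  have ns0 : 0 <= - s by lra.
  have ts0 : 0 <= t + s by lra.
  have -> : rscale s^-1 (T (t + s) y - T t y) - - T t (A y) =
      T (t + s) (rscale (- s)^-1 (T (- s) y - y) - - A y + (T (- s) (A y) - A y)).
    have ts x : T (t + s) (T (- s) x) = T t x by rewrite -(C0_add semi)// addrK.
    rewrite !opprK invrN rscaleNl -rscaleNr opprB !sgD// sgN// sgZ// !sgB// !ts.
    by rewrite -addrA; congr (_ + _); rewrite addrC subrK.
  have tsb : t + s < b by lra.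
  apply: le_trans (bndT _ ts0 tsb) _.
  by rewrite ler_wpM2l//; exact: rnormD.
Unshelve. all: by end_near. Qed.
End Bounded.
End Semigroup.

Section Smoothing.
Context {R : realType} {H : hilbertType R}.
Variables (A : operator H) (c K : R) (T : R -> H -> H).
Hypotheses (secA : sectorial A c K) (semi : C0_semigroup T)
  (gen : is_generator (opp_operator A) T).
Implicit Types (x y : H) (t s : R).

Lemma sg_contraction t x : 0 <= t -> rnorm (T t x) <= rnorm x.
Proof.
have [b [M [b0 M0 bnd]]] := sg_locally_bounded semi.
have c0 := sect_c_gt0 secA.
have domb y s : 0 <= s -> s < b -> dom A y -> rnorm (T s y) <= rnorm y.
  rewrite le_eqVlt => /orP[/eqP <- _ _|s0 sb dy]; first by rewrite (C0_0 semi).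
  rewrite -(@ler_pXn2r _ 2)// ?nnegrE ?rnorm_ge0// -!rip_sqr.
  have [r r0 rs|r|xi [xi0 xis]] := @MVT_right _ (fun r => rip (T r y) (T r y))
     (fun r => rip (- T r (A y)) (T r y) + rip (T r y) (- T r (A y))) _ _ s0.
  - by apply: is_derive_rip; apply: (sg_deriv_bounded semi gen M0 bnd) => //; exact: le_lt_trans sb.
  - rewrite !(C0_0 semi); apply: cvg_rip; exact: (@C0_strong _ _ _ semi y).
  have [dxi <-] := sg_commute semi gen (ltW xi0) dy.
  rewrite (C0_0 semi) !ripE subr0 => e; rewrite -subr_le0 e.
  rewrite pmulr_lle0// (ripC (T xi y)).
  have := sect_coercive secA dxi.
  have : 0 <= c * rnorm (T xi y) ^+ 2 by rewrite mulr_ge0 ?sqr_ge0// ltW.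
  lra.
have allb y s : 0 <= s -> s < b -> rnorm (T s y) <= rnorm y.
  move=> s0 sb; apply/ler_addgt0Pr => e e0.
  have e'0 : 0 < e / (M + 1) by rewrite divr_gt0// ltr_wpDl.
  have [z dz yz] := sect_dense secA y e'0.
  have -> : T s y = T s (y - z) + T s z by rewrite -(sgD semi)// subrK.
  apply: le_trans (rnormD _ _) _.
  apply: (@le_trans _ _ (M * rnorm (y - z) + rnorm z)).
    by apply: lerD; [exact: bnd|exact: domb].
  have := rnorm_distD y z 0; rewrite !subr0 (rnormBC z) => h1.
  have M1 : 0 < M + 1 by rewrite ltr_wpDl.
  have : (M + 1) * rnorm (y - z) <= e by rewrite mulrC -ler_pdivlMr// ltW.
  lra.
have b2 : 0 < b / 2 by rewrite divr_gt0.
have iterb n s y : 0 <= s -> s <= n%:R * (b / 2) -> rnorm (T s y) <= rnorm y.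
  elim: n s y => [|n IH] s y s0.
    rewrite mul0r => s0'; have -> : s = 0 by apply/eqP; rewrite eq_le s0 s0'.
    by rewrite (C0_0 semi).
  have [sb _|sb sn] := ltP s (b / 2); first by apply: allb => //; lra.
  have -> : s = (b / 2) + (s - b / 2) by rewrite addrC subrK.
  have sb0 : 0 <= s - b / 2 by rewrite subr_ge0.
  rewrite (C0_add semi)//; last exact: ltW.
  apply: le_trans (allb _ _ (ltW b2) _) _; first by lra.
  by apply: IH => //; move: sn; rewrite -natr1; lra.
move=> t0; apply: (iterb (Num.bound (t / (b / 2)))) => //.
by rewrite -ler_pdivrMr// ltW// archi_boundP// divr_ge0// ltW.
Qed.

Lemma sg_deriv t y : 0 < t -> dom A y -> has_deriv (fun s => T s y) t (- T t (A y)).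
Proof.
move=> t0; apply: (@sg_deriv_bounded _ _ _ _ semi gen (t + 1) 1) => //; last by rewrite ltrDl.
by move=> s x s0 _; rewrite mul1r; exact: sg_contraction.
Qed.

Lemma sect_lower_bound x : dom A x -> c * rnorm x <= rnorm (A x).
Proof.
move=> dx; have [->|x0] := eqVneq x 0; first by rewrite rnorm0 mulr0 rnorm_ge0.
have nx : 0 < rnorm x by rewrite rnorm_gt0.
rewrite -(ler_pM2r nx) -mulrA -expr2; apply: le_trans (sect_coercive secA dx) _.
by apply: le_trans (ler_norm _) _; exact: cauchy_schwarz.
Qed.

Lemma sect_domB x y : dom A x -> dom A y -> dom A (x - y) /\ A (x - y) = A x - A y.
Proof. by move=> dx dy; have := sect_linear secA (-1) dx dy; rewrite !rscaleNl !rscale1. Qed.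

Lemma sect0 : dom A 0 /\ A 0 = 0.
Proof.
have [x dx _] := sect_surjective secA 0.
by have := sect_domB dx dx; rewrite !subrr.
Qed.

Lemma sect_closed (u : nat -> H) x y : (forall n, dom A (u n)) ->
  u @ \oo --> x -> A (u n) @[n --> \oo] --> y -> dom A x /\ A x = y.
Proof.
move=> du ux uy; have [z dz zy] := sect_surjective secA y.
suff -> : x = z by [].
apply: (rnorm_cvg_unique _ ux).
have h : c^-1 * rnorm (A (u n) - y) @[n --> \oo] --> (0 : R).
  rewrite -[X in _ --> X](mulr0 c^-1).
  by apply: cvgM; [exact: cvg_cst|exact: cvg_rnorm_sub].
apply: (cvg_rnorm_le _ h); near=> n.
have [d e] := sect_domB (du n) dz.
have c0 := sect_c_gt0 secA.
by rewrite /= -(ler_pM2l c0) mulrA divff ?gt_eqF// mul1r -zy -e; exact: sect_lower_bound.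
Unshelve. all: by end_near. Qed.

Lemma sect_dense_square x : exists u : nat -> H,
  [/\ forall n, dom A (u n), forall n, dom A (A (u n)) & u @ \oo --> x].
Proof.
have c0 := sect_c_gt0 secA.
have /choice [u hu] n : exists z, [/\ dom A z, dom A (A z) & rnorm (z - x) <= n.+1%:R^-1].
  have n0 : 0 < n.+1%:R^-1 / 2 :> R by rewrite divr_gt0// invr_gt0.
  have [y dy xy] := sect_dense secA x n0.
  have [w dw yw] := sect_dense secA (A y) (mulr_gt0 c0 n0).
  have [z dz zw] := sect_surjective secA w.
  exists z; split=> //; first by rewrite zw.
  apply: le_trans (rnorm_distD y _ _) _.
  have [d e] := sect_domB dy dz.
  have := sect_lower_bound d; rewrite e zw (rnormBC z y) (rnormBC y x) => h.
  have : rnorm (y - z) < n.+1%:R^-1 / 2 by rewrite -(ltr_pM2l c0); exact: le_lt_trans h yw.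
  by move: xy; move: (_^-1) => k; lra.
exists u; split=> [n|n|]; [by have [] := hu n|by have [] := hu n|].
apply: (cvg_rnorm_le _ (@cvg_harmonic R)); near=> n.
by have [] := hu n.
Unshelve. all: by end_near. Qed.

(* [s^2 |A u(s)|^2 + K^2 |u(s)|^2] is nonincreasing along orbits. *)
Lemma sg_smoothing_dom t x : 0 < t -> dom A x -> dom A (A x) ->
  t * rnorm (A (T t x)) <= K * rnorm x.
Proof.
move=> t0 dx dAx; have K0 := sect_K_gt0 secA.
rewrite -(@ler_pXn2r _ 2)// ?nnegrE ?mulr_ge0 ?rnorm_ge0 ?(ltW t0) ?(ltW K0)// !exprMn.
have [_ ->] := sg_commute semi gen (ltW t0) dx.
pose F1 s := rip (T s (A x)) (T s (A x)); pose F2 s := rip (T s x) (T s x).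
pose l1 s := rip (- T s (A (A x))) (T s (A x)) + rip (T s (A x)) (- T s (A (A x))).
pose l2 s := rip (- T s (A x)) (T s x) + rip (T s x) (- T s (A x)).
have [s s0 _||xi [xi0 xit]] := @MVT_right _ (fun s => s ^+ 2 * F1 s + K ^+ 2 * F2 s)
    (fun s => 2 * s * F1 s + s ^+ 2 * l1 s + K ^+ 2 * l2 s) _ _ t0.
- have d1 : is_derive s 1 F1 (l1 s) by apply: is_derive_rip; exact: sg_deriv.
  have d2 : is_derive s 1 F2 (l2 s) by apply: is_derive_rip; exact: sg_deriv.
  apply: (is_derive_eqfun (is_deriveD (is_deriveM (is_deriveX 2 (is_derive_id s 1)) d1)
    (is_deriveZ (K ^+ 2) d2))) => [r|]; first by rewrite !fctE.
  by rewrite fctE /GRing.scale /=; ring.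
- apply: cvgD; apply: cvgM; last first.
  + by rewrite /F2 !(C0_0 semi); apply: cvg_rip; exact: (@C0_strong _ _ _ semi x).
  + exact: cvg_cst.
  + by rewrite /F1 !(C0_0 semi); apply: cvg_rip; exact: (@C0_strong _ _ _ semi (A x)).
  + by apply: cvg_at_right_filter; exact: exprn_continuous.
rewrite /F1 /F2 !(C0_0 semi) /l1 /l2 expr0n mul0r add0r subr0 !rip_sqr.
have [d1 e1] := sg_commute semi gen (ltW xi0) dx.
have [d2 e2] := sg_commute semi gen (ltW xi0) dAx.
have dd : dom A (A (T xi x)) by rewrite e1.
have := sect_square secA d1 dd (ltW xi0); rewrite e1 e2 => h e.
have : 0 <= K ^+ 2 * rnorm (T t x) ^+ 2 by rewrite mulr_ge0 ?sqr_ge0.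
have : t ^+ 2 * rnorm (T t (A x)) ^+ 2 + K ^+ 2 * rnorm (T t x) ^+ 2 - K ^+ 2 * rnorm x ^+ 2 <= 0.
  rewrite e pmulr_lle0// !ripNl !ripNr (ripC (T xi x)) (ripC (T xi (A x)) (T xi (A (A x)))).
  move: h; lra.
lra.
Qed.

Lemma sg_smoothing t x : 0 < t ->
  dom A (T t x) /\ t * rnorm (A (T t x)) <= K * rnorm x.
Proof.
move=> t0; have [u [du dAu ux]] := sect_dense_square x.
have Tc y : {for y, continuous (T t)} by exact: (C0_continuous semi (ltW t0)).
have Tu : T t (u n) @[n --> \oo] --> T t x by apply: (cvg_comp _ _ ux); exact: Tc.
have dTu n : dom A (T t (u n)) by have [] := sg_commute semi gen (ltW t0) (du n).
have K0 := sect_K_gt0 secA.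
have [y Ay] : exists y : H, A (T t (u n)) @[n --> \oo] --> y.
  apply: rnorm_complete => e e0.
  have [N hN] := cvg_rnorm_cauchy ux (divr_gt0 (mulr_gt0 t0 e0) K0).
  exists N => m n Nm Nn; rewrite -(ltr_pM2l t0).
  have [_ <-] := sect_domB (dTu m) (dTu n).
  have [d Ae] := sect_domB (du m) (du n).
  have [dd _] := sect_domB (dAu m) (dAu n).
  rewrite -(sgB semi) ?ltW//.
  apply: le_lt_trans (sg_smoothing_dom t0 d _) _; first by rewrite Ae.
  by rewrite mulrC -ltr_pdivlMr// hN.
have [dx Ax] := sect_closed dTu Tu Ay; split=> //; rewrite Ax.
apply: (ler_cvg_to (cvgM (cvg_cst t) (cvg_rnorm Ay)) (cvgM (cvg_cst K) (cvg_rnorm ux))).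
by near=> n; exact: sg_smoothing_dom.
Unshelve. all: by end_near. Qed.

Lemma sg_iter n t x : 0 < t -> dom A (iter n A (T t x)) /\
  forall s, 0 <= s -> iter n A (T (s + t) x) = T s (iter n A (T t x)).
Proof.
elim: n t => [|n IH] t t0.
  split=> [|s s0] /=; first by have [] := sg_smoothing x t0.
  by rewrite (C0_add semi)// ltW.
have [dn en] := IH _ t0; split=> [|s s0] /=; last first.
  by rewrite en//; have [] := sg_commute semi gen s0 dn.
have t2 : 0 < t / 2 by rewrite divr_gt0.
have [dn2 en2] := IH _ t2.
rewrite [t]splitr en2 ?ltW//.
have [_ ->] := sg_commute semi gen (ltW t2) dn2.
by have [] := sg_smoothing (A (iter n A (T (t / 2) x))) t2.
Qed.

Lemma sg_iter_bound_mul n s x : 0 < s ->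
  s ^+ n * rnorm (iter n A (T (n%:R * s) x)) <= K ^+ n * rnorm x.
Proof.
move=> s0; elim: n => [|n IH]; first by rewrite !mul1r mul0r (C0_0 semi).
have -> : iter n.+1 A (T (n.+1%:R * s) x) = A (T s (iter n A (T (n%:R * s) x))).
  rewrite /= -natr1 mulrDl mul1r addrC; case: n {IH} => [|n].
    by rewrite /= !mul0r addr0 (C0_0 semi).
  by have [_ ->] := @sg_iter n.+1 (n.+1%:R * s) x (mulr_gt0 (ltr0Sn _ _) s0); rewrite ?ltW.
set y := iter _ _ _ in IH *.
rewrite exprSr exprS -!mulrA; apply: le_trans (_ : s ^+ n * (K * rnorm y) <= _).
  rewrite ler_pM2l ?exprn_gt0//; by have [] := sg_smoothing y s0.
by rewrite mulrCA ler_wpM2l// ltW// (sect_K_gt0 secA).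
Qed.

Lemma sg_iter_bound n r t x : 0 < r -> r <= t ->
  r ^+ n * rnorm (iter n A (T t x)) <= (n%:R * K) ^+ n * rnorm x.
Proof.
move=> r0 rt; case: n => [|n].
  by rewrite !expr0 !mul1r; apply: sg_contraction; lra.
have s0 : 0 < r / n.+1%:R by rewrite divr_gt0.
have := sg_iter_bound_mul n.+1 x s0.
have -> : n.+1%:R * (r / n.+1%:R) = r by rewrite mulrC divfK.
rewrite expr_div_n mulrAC ler_pdivrMr ?exprn_gt0// mulrAC -exprMn [K * _]mulrC.
apply: le_trans; rewrite ler_pM2l ?exprn_gt0//.
have -> : t = (t - r) + r by rewrite subrK.
have [_ ->] := @sg_iter n.+1 r x r0; last by rewrite subr_ge0.
by apply: sg_contraction; rewrite subr_ge0.
Qed.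

Lemma sg_iter_deriv n t x : 0 < t ->
  has_deriv (fun s => iter n A (T s x)) t (- iter n.+1 A (T t x)).
Proof.
move=> t0; have t2 : 0 < t / 2 by rewrite divr_gt0.
have [d e] := sg_iter n x t2.
have := sg_deriv t2 d.
have [_ <-] := sg_commute semi gen (ltW t2) d.
rewrite -e ?ltW// -[t / 2 + t / 2]splitr; apply: cvg_trans.
apply: near_eq_cvg; near=> s.
have ts : 0 <= t / 2 + s.
  suff : `|s| < t / 2 by rewrite ltr_norml; lra.
  by near: s; exact: dnbhs0_lt t2.
rewrite -!e//; last exact: ltW.
have -> : t / 2 + s + t / 2 = t + s by lra.
by rewrite -splitr.
Unshelve. all: by end_near. Qed.

Lemma sg_taylor r tau x : 0 < r -> r <= tau -> T tau x = 0 ->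
  forall n k t w, r <= t -> t <= tau ->
  r ^+ (k + n) * rip (iter k A (T t x)) w <=
  ((k + n)%:R * K) ^+ (k + n) * rnorm x * rnorm w * ((tau - t) ^+ n / n`!%:R).
Proof.
move=> r0 rtau Ttau; elim=> [|n IH] k t w rt ttau.
  rewrite addn0 expr0 fact0 divr1 mulr1.
  apply: le_trans (_ : r ^+ k * (rnorm (iter k A (T t x)) * rnorm w) <= _).
    by rewrite ler_pM2l ?exprn_gt0//; apply: le_trans (ler_norm _) (cauchy_schwarz _ _).
  by rewrite mulrA ler_wpM2r ?rnorm_ge0//; exact: sg_iter_bound.
have iter0 m : iter m A 0 = 0 by elim: m => //= m ->; have [] := sect0.
set C := _ ^+ (k + n.+1) * rnorm x * rnorm w; set N := (k + n.+1)%N.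
move: ttau; rewrite le_eqVlt => /orP[/eqP ->|ttau].
  by rewrite Ttau iter0 rip0l mulr0 subrr expr0n /= mul0r mulr0.
pose g s := rip (iter k A (T s x)) w.
pose q s := (tau - s) ^+ n.+1.
have dq s : is_derive s 1 q (- (n.+1%:R * (tau - s) ^+ n)).
  apply: (is_derive_eqfun (is_deriveX n.+1 (is_deriveB (is_derive_cst tau s 1) (is_derive_id s 1)))) => [u|]; first by rewrite !fctE.
  by rewrite !fctE /GRing.scale /=; ring.
have dg s : 0 < s -> is_derive s 1 g (- rip (iter k.+1 A (T s x)) w).
  move=> s0; apply: (is_derive_eqfun (is_derive_rip (sg_iter_deriv (n := k) (x := x) s0) (has_deriv_cst w s))) => //.
  by rewrite !ripE addr0.
have dPhi s : 0 < s -> is_derive s 1 (fun s => r ^+ N * g s - C / n.+1`!%:R * q s)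
    (r ^+ N * - rip (iter k.+1 A (T s x)) w + C * ((tau - s) ^+ n / n`!%:R)).
  move=> s0; apply: (is_derive_eqfun (is_deriveB (is_deriveZ (r ^+ N) (dg s s0))
    (is_deriveZ (C / n.+1`!%:R) (dq s)))) => [u|]; first by rewrite !fctE.
  rewrite /GRing.scale /= factS natrM; field.
  by rewrite addrC natr1 !pnatr_eq0 -!lt0n fact_gt0.
have t0 : 0 < t by exact: lt_le_trans rt.
have [s ts _||xi [txi xitau]] := MVT_right ttau (f := fun s => r ^+ N * g s - C / n.+1`!%:R * q s)
   (df := fun s => r ^+ N * - rip (iter k.+1 A (T s x)) w + C * ((tau - s) ^+ n / n`!%:R)).
- by apply: dPhi; lra.
- exact: cvg_at_right_filter (is_derive_continuous (dPhi _ t0)).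
rewrite /g /q Ttau iter0 rip0l mulr0 subrr expr0n /= mulr0 subrr sub0r opprB => e.
rewrite -subr_ge0 -/C (_ : C * _ - _ = C / n.+1`!%:R * (tau - t) ^+ n.+1 - r ^+ N * rip (iter k A (T t x)) w); last by ring.
rewrite e; apply: mulr_ge0; last lra.
have := IH k.+1 xi w; rewrite addSnnS -/N -/C mulrN => h.
by rewrite addrC subr_ge0 h//; lra.
Qed.

Lemma expn_le_fact n : n%:R ^+ n <= expR 1 ^+ n * n`!%:R :> R.
Proof.
elim: n => [|n IH]; first by rewrite !expr0 fact0 mulr1.
rewrite !exprS factS natrM.
suff h : n.+1%:R ^+ n <= expR 1 * n%:R ^+ n :> R.
  rewrite (_ : _ * _ * _ = n.+1%:R * (expR 1 * (expR 1 ^+ n * n`!%:R))); last by ring.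
  rewrite ler_pM2l//; apply: le_trans h _; rewrite ler_pM2l//; exact: expR_gt0.
case: n {IH} => [|n].
  by rewrite !expr0 mulr1; apply: le_trans (expR_ge1Dx 1); rewrite lerDl.
have n0 : 0 < n.+1%:R :> R by [].
have -> : expR 1 = expR (n.+1%:R^-1) ^+ n.+1 :> R.
  by rewrite -expRM_natl divff// gt_eqF.
rewrite -exprMn ler_pXn2r ?nnegrE// ?mulr_ge0 ?expR_ge0//.
rewrite mulrC -ler_pdivrMl//; apply: le_trans (expR_ge1Dx _).
by rewrite -[n.+2%:R]natr1 mulrDr mulVf ?gt_eqF// mulr1 addrC.
Qed.

End Smoothing.

(** * Backward uniqueness *)
Section BackwardUniqueness.
Context {R : realType} {H : hilbertType R}.
Variables (A : operator H) (c K : R) (T : R -> H -> H).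
Hypotheses (secA : sectorial A c K) (semi : C0_semigroup T)
  (gen : is_generator (opp_operator A) T).
Implicit Types (x y : H) (t s : R).

Lemma sg_vanish_earlier t tau x : 0 < t -> t <= tau ->
  expR 1 * K * (tau - t) = t / 2 -> T tau x = 0 -> T t x = 0.
Proof.
move=> t0 ttau tE Ttau; apply/eqP; rewrite -rnorm_eq0 eq_le rnorm_ge0 andbT.
have K0 := sect_K_gt0 secA.
have [->//|nx0] := eqVneq (rnorm (T t x)) 0.
have nx : 0 < rnorm (T t x) by rewrite lt_def nx0 rnorm_ge0.
have q1 : `|2^-1 : R| < 1 by rewrite gtr0_norm// invf_lt1// ltr1n.
have l : 2^-1 ^+ n * rnorm x @[n --> \oo] --> (0 : R).
  rewrite -[X in _ --> X](mul0r (rnorm x)).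
  by apply: cvgM; [exact: cvg_expr|exact: cvg_cst].
apply: (ler_cvg_to (cvg_cst _) l); near=> n.
have := sg_taylor secA semi gen t0 ttau Ttau n 0 (T t x) (lexx t) ttau.
rewrite add0n /= rip_sqr expr2 mulrA [_ * rnorm (T t x) * _]mulrAC (ler_pM2r nx) => h.
have tn : 0 < t ^+ n by rewrite exprn_gt0.
rewrite -(ler_pM2l tn); apply: le_trans h _.
have n0 : 0 < n`!%:R :> R by rewrite ltr0n fact_gt0.
have -> : t ^+ n * (2^-1 ^+ n * rnorm x) = expR 1 ^+ n * K ^+ n * rnorm x * (tau - t) ^+ n.
  by rewrite mulrA -exprMn -tE !exprMn; ring.
rewrite mulrA ler_pdivrMr// [X in _ <= X]mulrAC ler_wpM2r//.
  by rewrite exprn_ge0// subr_ge0.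
rewrite [X in _ <= X]mulrAC ler_wpM2r ?rnorm_ge0// exprMn.
rewrite [X in _ <= X]mulrAC ler_wpM2r ?exprn_ge0//; first exact: ltW.
exact: expn_le_fact.
Unshelve. all: by end_near. Qed.

Lemma sg_injective tau x : 0 <= tau -> T tau x = 0 -> x = 0.
Proof.
rewrite le_eqVlt => /orP[/eqP <-|tau0 Ttau]; first by rewrite (C0_0 semi).
have K0 := sect_K_gt0 secA.
pose k : R := 2 * (expR 1 * K); have k0 : 0 < k by rewrite !mulr_gt0// expR_gt0.
pose q := k / (k + 1); have q0 : 0 < q by rewrite divr_gt0// addr_gt0.
have q1 : q < 1 by rewrite ltr_pdivrMr ?addr_gt0// mul1r ltrDl.
have Tq n : T (q ^+ n * tau) x = 0.
  elim: n => [|n IH]; first by rewrite expr0 mul1r.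
  have qn : 0 < q ^+ n * tau by rewrite mulr_gt0// exprn_gt0.
  apply: sg_vanish_earlier IH; first by rewrite mulr_gt0// exprn_gt0.
    by rewrite exprS -mulrA ger_pMl// ltW.
  rewrite exprS -[q * _ * tau]mulrA; move: (q ^+ n * tau) => r.
  by rewrite /q /k; field; rewrite -/k gt_eqF// addr_gt0.
apply/eqP; rewrite -rnorm_eq0; apply: contraT => nx0.
have nx : 0 < rnorm x by rewrite lt_def nx0 rnorm_ge0.
have /cvg_rnormP /(_ _ nx) /nbhs_ballP [d /= d0 hd] := @C0_strong _ _ _ semi x.
have q1' : `|q| < 1 by rewrite gtr0_norm.
have l : q ^+ n * tau @[n --> \oo] --> (0 : R).
  rewrite -[X in _ --> X](mul0r tau).
  by apply: cvgM; [exact: cvg_expr|exact: cvg_cst].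
move/cvgrPdist_lt : l => /(_ _ d0) [N _ /(_ N (leqnn N))] /= hN.
have := hd _ hN; rewrite Tq sub0r rnormN ltxx; apply.
by rewrite mulr_gt0// exprn_gt0.
Qed.

Lemma sectZ r x : dom A x -> dom A (rscale r x) /\ A (rscale r x) = rscale r (A x).
Proof.
move=> dx; have [d0 A0] := sect0 secA.
by have := sect_linear secA r d0 dx; rewrite A0 !add0r.
Qed.

Lemma sect_rip_gt0 x : dom A x -> x != 0 -> 0 < rip (A x) x.
Proof.
move=> dx x0; apply: lt_le_trans (sect_coercive secA dx).
by rewrite mulr_gt0 ?(sect_c_gt0 secA)// exprn_gt0// rnorm_gt0.
Qed.

Definition strict_convexity_condition : Prop :=
  forall x, dom A x -> dom A (A x) -> x != 0 ->
    rip (A x) x ^+ 2 < (rnorm (A x) ^+ 2 + rip (A (A x)) x) * rnorm x ^+ 2.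

Lemma hyponormal_condition : hyponormal A -> strict_convexity_condition.
Proof.
move=> [domS le] x dx dAx x0.
have [z0 hz0] := domS _ dx.
have adj : adjoint_at A x (adjoint A x) by exact: xgetI hz0.
set z := adjoint A x in adj.
have zE y : dom A y -> rip (A y) x = rip y z by move=> dy; rewrite /rip adj.
have r0 := sect_rip_gt0 dx x0.
have hz : rnorm z ^+ 2 <= rnorm (A x) ^+ 2.
  by rewrite ler_pXn2r ?nnegrE ?rnorm_ge0//; exact: le.
have := cauchy_schwarz_sqr (A x + z) x.
have zx : rip z x = rip (A x) x by rewrite ripC -zE.
rewrite (ripDl _ _ x) zx !ripE (ripC z (A x)) -(zE _ dAx) !rip_sqr => cs.
have x2 : 0 <= rnorm x ^+ 2 by exact: sqr_ge0.
have := ler_wpM2r x2 hz.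
have : 0 < rip (A x) x ^+ 2 by rewrite exprn_gt0.
move: cs; lra.
Qed.

(* In the equality case [A x = l x] with [l > 0], so [Re(A^2 x|x) > 0]. *)
Lemma accretive_square_condition : accretive (square A) -> strict_convexity_condition.
Proof.
move=> acc x dx dAx x0.
have nx : 0 < rnorm x by rewrite rnorm_gt0.
have pos : 0 <= rip (A (A x)) x.
  have [d1 e1] := sectZ (rnorm x)^-1 dx.
  have [d2 e2] := sectZ (rnorm x)^-1 dAx.
  have : (0 <= (rip (A (A (rscale (rnorm x)^-1 x))) (rscale (rnorm x)^-1 x))%:E)%E.
    apply: le_trans acc _; apply: ereal_inf_lbound.
    exists (rscale (rnorm x)^-1 x) => //; split; first by rewrite /= e1.
    by rewrite rnormZ gtr0_norm ?invr_gt0// mulVf// gt_eqF.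
  by rewrite lee_fin e1 e2 !ripE !pmulr_rge0// invr_gt0.
have r0 := sect_rip_gt0 dx x0.
have cs := cauchy_schwarz_sqr (A x) x; rewrite !rip_sqr in cs.
have pos' : 0 <= rip (A (A x)) x * rnorm x ^+ 2 by rewrite mulr_ge0// sqr_ge0.
rewrite mulrDl lt_def; apply/andP; split; last by lra.
apply/eqP => e.
have e1 : rip (A x) x ^+ 2 = rnorm (A x) ^+ 2 * rnorm x ^+ 2 by lra.
have e2 : rip (A (A x)) x * rnorm x ^+ 2 = 0 by lra.
have x2 : rnorm x ^+ 2 != 0 by rewrite gt_eqF// exprn_gt0.
have [l l0 Ax] : exists2 l, 0 < l & A x = rscale l x.
  exists (rip (A x) x / rnorm x ^+ 2); first by rewrite divr_gt0// exprn_gt0.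
  apply/eqP; rewrite -subr_eq0 -rnorm_eq0 -sqrf_eq0 -[rnorm (A x - _) ^+ 2]rip_sqr.
  rewrite !ripE (ripC x) !rip_sqr.
  have -> : rnorm (A x) ^+ 2 = rip (A x) x ^+ 2 / rnorm x ^+ 2 by rewrite e1 mulfK.
  by apply/eqP; field; rewrite gt_eqF.
move: e2; rewrite Ax; have [_ ->] := sectZ l dx; rewrite Ax !ripE rip_sqr => /eqP.
by rewrite !mulf_eq0 rnorm_eq0 (negbTE x0) (gt_eqF l0).
Qed.

End BackwardUniqueness.

(** * Decay of the norm *)
Section Decay.
Context {R : realType} {H : hilbertType R}.
Variables (A : operator H) (c K : R) (T : R -> H -> H).
Hypotheses (secA : sectorial A c K) (semi : C0_semigroup T)
  (gen : is_generator (opp_operator A) T) (cond : strict_convexity_condition A).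
Variables (x : H) (x0 : x != 0).
Implicit Types (t s : R).

Let u t := T t x.
Let h t := rnorm (u t).
Let dh t := - (rip (A (u t)) (u t) / h t).

Let domu t : 0 < t -> dom A (u t).
Proof. by move=> t0; have [] := sg_iter secA semi gen 0 x t0. Qed.

Let domAu t : 0 < t -> dom A (A (u t)).
Proof. by move=> t0; have [] := sg_iter secA semi gen 1 x t0. Qed.

Let u_neq0 t : 0 <= t -> u t != 0.
Proof. by move=> t0; apply: contra_neq x0; exact: sg_injective secA semi gen _ _ t0. Qed.

Let h_gt0 t : 0 <= t -> 0 < h t.
Proof. by move=> t0; rewrite rnorm_gt0 u_neq0. Qed.

Let du t : 0 < t -> has_deriv u t (- A (u t)).
Proof. by move=> t0; exact: sg_iter_deriv secA semi gen 0 _ _ t0. Qed.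

Let dAu t : 0 < t -> has_deriv (fun s => A (u s)) t (- A (A (u t))).
Proof. by move=> t0; exact: sg_iter_deriv secA semi gen 1 _ _ t0. Qed.

Let hE t : h t = Num.sqrt (rip (u t) (u t)).
Proof. by rewrite rip_sqr sqrtr_sqr ger0_norm// rnorm_ge0. Qed.

Lemma is_derive_norm t : 0 < t -> is_derive t 1 h (dh t).
Proof.
move=> t0; have ht := h_gt0 (ltW t0).
have f0 : 0 < rip (u t) (u t) by rewrite rip_sqr exprn_gt0.
have d1 := is_derive_rip (du t0) (du t0).
apply: (is_derive_eqfun (is_derive1_comp (is_derive1_sqrt f0) d1)) => [s|].
  by rewrite /= -hE.
by rewrite -hE /dh ripNl ripNr (ripC (u t)); field; rewrite gt_eqF.
Qed.

Let ddh t := (rnorm (A (u t)) ^+ 2 + rip (A (A (u t))) (u t)) / h t -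
  rip (A (u t)) (u t) ^+ 2 / h t ^+ 3.

Lemma is_derive_dnorm t : 0 < t -> is_derive t 1 dh (ddh t).
Proof.
move=> t0; have ht := h_gt0 (ltW t0); have hn : h t != 0 by rewrite gt_eqF.
have d1 := is_derive_rip (dAu t0) (du t0).
apply: (is_derive_eqfun (is_deriveN (is_deriveM d1 (is_deriveV hn (is_derive_norm t0))))) => [s|].
  by rewrite !fctE.
rewrite /GRing.scale /= /ddh /dh !ripE rip_sqr; field; exact: hn.
Qed.

Lemma ddnorm_gt0 t : 0 < t -> 0 < ddh t.
Proof.
move=> t0; have ht := h_gt0 (ltW t0).
have := cond (domu t0) (domAu t0) (u_neq0 (ltW t0)); rewrite -/(h t) => k.
rewrite /ddh (_ : _ - _ = ((rnorm (A (u t)) ^+ 2 + rip (A (A (u t))) (u t)) * h t ^+ 2 -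
  rip (A (u t)) (u t) ^+ 2) / h t ^+ 3); last by field; rewrite gt_eqF.
by rewrite divr_gt0 ?exprn_gt0// subr_gt0.
Qed.

Lemma dnorm_increasing s t : 0 < s -> s < t -> dh s < dh t.
Proof.
move=> s0 st; have [r sr _||xi [sxi _ e]] := @MVT_right _ dh ddh _ _ st.
- by apply: is_derive_dnorm; lra.
- exact: cvg_at_right_filter (is_derive_continuous (is_derive_dnorm s0)).
rewrite -subr_gt0 e; apply: mulr_gt0; last by rewrite subr_gt0.
by apply: ddnorm_gt0; lra.
Qed.

Lemma dnorm_lt0 t : 0 < t -> dh t < 0.
Proof.
move=> t0; rewrite oppr_lt0 divr_gt0 ?h_gt0 ?ltW//.
by apply: (sect_rip_gt0 secA) (domu t0) (u_neq0 (ltW t0)).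
Qed.

Lemma norm_right_continuous t : 0 <= t -> h s @[s --> t^'+] --> h t.
Proof.
rewrite le_eqVlt => /orP[/eqP <-|t0].
  by rewrite /h /u (C0_0 semi); apply: cvg_rnorm; exact: (@C0_strong _ _ _ semi x).
exact: cvg_at_right_filter (is_derive_continuous (is_derive_norm t0)).
Qed.

Lemma norm_MVT s t : 0 <= s -> s < t ->
  exists xi, [/\ s < xi, xi < t & h t - h s = dh xi * (t - s)].
Proof.
move=> s0 st; apply: (MVT_right st) => [r sr _|]; last exact: norm_right_continuous.
by apply: is_derive_norm; lra.
Qed.

Lemma norm_strictly_decreasing : strictly_decreasing_on [set t | 0 <= t] h.
Proof.
move=> s t /= s0 _ st; have [xi [sxi _ e]] := norm_MVT s0 st.
by rewrite -subr_lt0 e nmulr_rlt0 ?subr_gt0// dnorm_lt0//; lra.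
Qed.

Lemma norm_strictly_convex : strictly_convex_on [set t | 0 <= t] h.
Proof.
have main s t l : 0 <= s -> s < t -> 0 < l -> l < 1 ->
    h (l * s + (1 - l) * t) < l * h s + (1 - l) * h t.
  move=> s0 st l0 l1; set m := _ + _.
  have ms : m - s = (1 - l) * (t - s) by rewrite /m; ring.
  have tm : t - m = l * (t - s) by rewrite /m; ring.
  have l1' : 0 < 1 - l by rewrite subr_gt0.
  have ts : 0 < t - s by rewrite subr_gt0.
  have sm : s < m by rewrite -subr_gt0 ms mulr_gt0.
  have mt : m < t by rewrite -subr_gt0 tm mulr_gt0.
  have [xi1 [sxi1 xi1m e1]] := norm_MVT s0 sm.
  have [xi2 [mxi2 xi2t e2]] := norm_MVT (le_trans s0 (ltW sm)) mt.
  have lt : dh xi1 < dh xi2 by apply: dnorm_increasing; lra.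
  have k0 : 0 < l * (1 - l) * (t - s) by rewrite !mulr_gt0.
  have : l * (h m - h s) < (1 - l) * (h t - h m).
    rewrite e1 e2 ms tm.
    by rewrite -(ltr_pM2l k0) in lt; lra.
  lra.
move=> s t l /= s0 t0 st l0 l1; move: st; rewrite neq_lt => /orP[st|ts].
  exact: main.
rewrite (_ : l * s + _ = (1 - l) * t + (1 - (1 - l)) * s); last by ring.
rewrite (_ : l * h s + _ = (1 - l) * h t + (1 - (1 - l)) * h s); last by ring.
by apply: main => //; lra.
Qed.

Lemma norm_slope_homo s t : 0 < s -> s <= t -> (h s - h 0) / s <= (h t - h 0) / t.
Proof.
move=> s0; rewrite le_eqVlt => /orP[/eqP -> //|st].
have t0 : 0 < t by lra.
have := @norm_strictly_convex 0 t (1 - s / t) (lexx 0) (ltW t0).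
rewrite eq_sym gt_eqF// mulr0 add0r opprB addrCA subrr addr0 divfK ?gt_eqF// => /(_ isT).
have st0 : 0 < s / t by rewrite divr_gt0.
have st1 : s / t < 1 by rewrite ltr_pdivrMr// mul1r.
move=> /(_ ltac:(lra) ltac:(lra)) lt.
rewrite ler_pdivrMr// mulrAC -mulrA.
have -> : (h t - h 0) * (s / t) = s / t * h t - s / t * h 0 by ring.
by move: lt; lra.
Qed.

Lemma norm_slope_dom : dom A x -> rnorm x = 1 ->
  (h t - h 0) / t @[t --> 0^'+] --> - rip (A x) x.
Proof.
move=> dx x1.
have h0 : h 0 = 1 by rewrite /h /u (C0_0 semi).
have q := sg_generator gen dx.
have ux := @C0_strong _ _ _ semi x.
have hl := norm_right_continuous (lexx 0); rewrite h0 in hl.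
have l : (rip (rscale t^-1 (T t x - x)) (T t x) + rip x (rscale t^-1 (T t x - x))) / (h t + 1)
   @[t --> 0^'+] --> (rip (- A x) x + rip x (- A x)) / (1 + 1).
  apply: cvgM.
    by apply: cvgD; apply: cvg_rip => //; exact: cvg_cst.
  by apply: cvgV; [rewrite gt_eqF|apply: cvgD => //; exact: cvg_cst].
rewrite (_ : _ / (1 + 1) = - rip (A x) x) in l; last by rewrite !ripE (ripC x); field.
apply: cvg_trans l; apply: near_eq_cvg; near=> t.
have t0 : 0 < t by near: t; exact: nbhs_right_gt.
have ht := h_gt0 (ltW t0).
rewrite /= !ripE !rip_sqr x1 (ripC x (T t x)) -/(u t) -/(h t) h0; field.
by rewrite gt_eqF//= gt_eqF// addr_gt0.
Unshelve. all: by end_near. Qed.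

Lemma lower_bound_le_slope t : 0 < t ->
  (lower_bound A <= (- ((h t - h 0) / t / h t))%:E)%E.
Proof.
move=> t0; have ht := h_gt0 (ltW t0).
have [d e] := sectZ secA (h t)^-1 (domu t0).
apply: (@le_trans _ _ (- (dh t / h t))%:E).
  apply: ereal_inf_lbound; exists (rscale (h t)^-1 (u t)).
    by split=> //; rewrite rnormZ gtr0_norm ?invr_gt0// -/(h t) mulVf// gt_eqF.
  by congr (_%:E); rewrite -[LHS]/(rip _ _) e !ripE /dh; field; rewrite gt_eqF.
rewrite lee_fin lerN2 ler_pM2r ?invr_gt0//.
have [xi [xi0 xit ->]] := norm_MVT (lexx 0) t0.
by rewrite subr0 mulfK ?gt_eqF// ltW// dnorm_increasing.
Qed.

End Decay.

Theorem proposition4 (R : realType) (V H : hilbertType R)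
    (sepV : separable V) (sepH : separable H)
    (j : {linear V -> H}) (hj : dense_embedding j)
    (a : sesquilinear_form V) (bnd_a : bounded_form a) (ell_a : elliptic_form a)
    (A : operator H) (hA : A = lax_milgram j a)
    (hyp : hyponormal A \/ accretive (square A))
    (expA : R -> H -> H) (semi : C0_semigroup expA)
    (gen : is_generator (opp_operator A) expA)
    (u0 : H) (u0_unit : rnorm u0 = 1)
    (h : R -> R) (hE : forall t, h t = rnorm (expA t u0)) :
  strictly_decreasing_on [set t | 0 <= t] h /\
  strictly_convex_on [set t | 0 <= t] h /\
  exists h'0 : \bar R,
    right_derivative h 0 h'0 /\
    h'0 <> +oo%E /\
    (h'0 = -oo%E -> ~ dom A u0) /\
    (dom A u0 -> h'0 = (- complex.Re (inner (A u0) u0))%:E) /\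
    (h'0 <= - lower_bound A)%E.
Proof.
have {h hE} -> : h = fun t => rnorm (expA t u0) by exact/funext.
have [c [K secA]] : exists c K, sectorial A c K.
  by rewrite hA; exact: lax_milgram_sectorial hj bnd_a ell_a.
have cond : strict_convexity_condition A.
  by case: hyp => [|]; [exact: (hyponormal_condition secA)|exact: (accretive_square_condition secA)].
have x0 : u0 != 0 by rewrite -rnorm_gt0 u0_unit.
have dec := norm_strictly_decreasing secA semi gen x0.
split=> //; split; first exact: (norm_strictly_convex secA semi gen cond x0).
pose h t := rnorm (expA t u0); rewrite -/h in dec *.
pose g t : R := (h t - h 0) / t.
have h0 : h 0 = 1 by rewrite /h (C0_0 semi).
pose l := ereal_inf [set (g t)%:E | t in [set` `]0, +oo[%R]].
have gl : (g t)%:E @[t --> 0^'+] --> l.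
  apply: (@nondecreasing_at_right_cvge _ (fun t => (g t)%:E) 0 +oo%O) => // s t.
  rewrite !in_itv /= !andbT lee_fin => s0 t0 st.
  exact: (norm_slope_homo secA semi gen cond x0).
have lg t : 0 < t -> (l <= (g t)%:E)%E.
  by move=> t0; apply: ereal_inf_lbound; exists t => //=; rewrite in_itv /= t0.
have ldom : dom A u0 -> l = (- complex.Re (inner (A u0) u0))%:E.
  move=> d; apply: (cvg_unique _ gl); first exact: ereal_hausdorff.
  by apply: cvg_EFin; [exact: nearW|exact: (norm_slope_dom secA semi gen x0 d u0_unit)].
have lfin : l <> +oo%E by move=> lE; have := lg 1 ltr01; rewrite lE leye_eq.
exists l; split; first by rewrite /right_derivative; under eq_fun do rewrite add0r.
split=> //; split; first by move=> lE /ldom; rewrite lE.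
split=> //.
rewrite leeNr; case: l gl lg ldom lfin => [r| |] // _ lg _ _; last by rewrite leey.
have h_gt0 t : 0 <= t -> 0 < h t.
  move=> t0; rewrite rnorm_gt0; apply: contra_neq x0.
  exact: (sg_injective secA semi gen t0).
have bnd t : 0 < t -> (lower_bound A <= (- r / h t)%:E)%E.
  move=> t0; apply: le_trans (lower_bound_le_slope secA semi gen cond x0 t0) _.
  rewrite lee_fin mulNr lerN2 ler_pM2r; first by rewrite -lee_fin lg.
  by rewrite invr_gt0 h_gt0// ltW.
have hl : - r / h t @[t --> 0^'+] --> - r.
  rewrite -[X in _ --> X]divr1 -h0.
  apply: cvgM; first exact: cvg_cst.
  apply: cvgV; first by rewrite h0 oner_neq0.
  exact: (norm_right_continuous secA semi gen x0 (lexx 0)).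
case: (lower_bound A) bnd => [m| |] bnd; last by rewrite leNye.
  rewrite lee_fin; apply: (ler_cvg_to (cvg_cst _) hl); near=> t.
  by rewrite -lee_fin; apply: bnd; near: t; exact: nbhs_right_gt.
by have := bnd 1 ltr01; rewrite leye_eq.
Unshelve. all: by end_near. Qed.
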